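(* Let $\Omega\subset S^{n-1}$ be a closed set not contained in any closed hemisphere of $S^{n-1}$. If $h_0:\Omega\to(0,\infty)$ and $f:\Omega\to\mathbb R$ are continuous, and $[h_t]$ is a logarithmic family of Wulff shapes associated with $(h_0,f)$, then, for $q\ne0$, $$\lim_{t\to0}\frac{\widetilde V_q([h_t])-\widetilde V_q([h_0])}{t}=q\int_\Omega f(v)\,d\widetilde C_q([h_0],v),$$ and $$\lim_{t\to0}\frac{\log\bar V_0([h_t])-\log\bar V_0([h_0])}{t}=\frac1{\omega_n}\int_\Omega f(v)\,d\widetilde C_0([h_0],v),$$ or equivalently, for all $q\in\mathbb R$, $$\frac{d}{dt}\log\bar V_q([h_t])\Big|_{t=0}=\frac1{\widetilde V_q([h_0])}\int_\Omega f(v)\,d\widetilde C_q([h_0],v).$$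
   Context: Logarithmic family of Wulff shapes associated with $(h_0,f)$: for some $\delta>0$ and each $t\in(-\delta,\delta)$, $h_t:\Omega\to(0,\infty)$ is continuous with $\log h_t(v)=\log h_0(v)+tf(v)+o(t,v)$, where $o(t,v)$ is continuous in $v\in\Omega$ and $o(t,v)/t\to0$ as $t\to0$ uniformly in $v\in\Omega$ (consistently with the given $h_0$ at $t=0$); $[h_t]=\{x\in\mathbb R^n:x\cdot v\le h_t(v)\text{ for all }v\in\Omega\}$, a convex body (compact convex set with non-empty interior) with the origin in its interior. For a convex body $K$ with the origin in its interior and $u,v\in S^{n-1}$: $h_K(v)=\max\{x\cdot v:x\in K\}$, $\rho_K(u)=\max\{\lambda:\lambda u\in K\}$, $r_K(u)=\rho_K(u)u$, $H_K(v)=\{x:x\cdot v=h_K(v)\}$. $du$ is spherical Lebesgue measure on $S^{n-1}$; $\omega_n$ is the volume of the unit ball of $\mathbb R^n$. Dual volumes: $\widetilde V_q(K)=\frac1n\int_{S^{n-1}}\rho_K^q(u)\,du$ for $q\in\mathbb R$; $\bar V_q(K)=\big(\frac1{n\omega_n}\int_{S^{n-1}}\rho_K^q(u)\,du\big)^{1/q}$ for $q\ne0$; $\bar V_0(K)=\exp\big(\frac1{n\omega_n}\int_{S^{n-1}}\log\rho_K(u)\,du\big)$. Dual curvature measures: $\pmb\alpha_K^*(\eta)=\{u\in S^{n-1}:r_K(u)\in H_K(v)\text{ for some }v\in\eta\}$ (Lebesgue measurable for Borel $\eta$), and $\widetilde C_q(K,\eta)=\frac1n\int_{\pmb\alpha_K^*(\eta)}\rho_K^q(u)\,du$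 for Borel $\eta\subset S^{n-1}$; this is a Borel measure. *)

(* Defs.v *)
From HB Require Import structures.
From mathcomp Require Import all_boot all_order all_algebra.
From mathcomp Require Import all_classical all_reals all_analysis.
From mathcomp Require Import measurable_realfun.
Import Order.TTheory GRing.Theory Num.Theory.
Import numFieldNormedType.Exports.

Set Implicit Arguments.
Unset Strict Implicit.
Unset Printing Implicit Defensive.

Local Open Scope classical_set_scope.
Local Open Scope ring_scope.

(* R^n is 'rV[R]_n with its library topology and its Borel sigma-algebra. *)
Section borel_rV.
Context (R : realType) (n : nat).

Let borel : set (set 'rV[R]_n) := <<s @open 'rV[R]_n >>.

Let borel0 : borel set0. Proof. exact: sigma_algebra0. Qed.

Let borelC A : borel A -> borel (~` A). Proof. exact: sigma_algebraC. Qed.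

Let borel_bigcup (F : (set 'rV[R]_n)^nat) :
  (forall i, borel (F i)) -> borel (\bigcup_i (F i)).
Proof. exact: sigma_algebra_bigcup. Qed.

HB.instance Definition _ := @isMeasurable.Build
  (sigma_display (@open 'rV[R]_n)) 'rV[R]_n borel borel0 borelC borel_bigcup.

Lemma measurable_rVE : @measurable _ 'rV[R]_n = <<s @open 'rV[R]_n >>.
Proof. by []. Qed.

End borel_rV.

Section measurable_rV.
Context (R : realType).

Lemma measurable_coord n (i : 'I_n) :
  measurable_fun [set: 'rV[R]_n] (fun x : 'rV[R]_n => x ord0 i).
Proof.
apply: (measurability _ (RGenOpens.measurableE R)) => _ [_ [a [b ->]] <-].
rewrite setTI; apply: sub_sigma_algebra.
apply: open_comp; last exact: interval_open.
by move=> x _; exact: coord_continuous.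
Qed.

Lemma open_rV_rational n (U : set 'rV[R]_n) : open U ->
  U = \bigcup_(p in [set p : 'rV[rat]_n * rat |
         (fun y : 'rV[R]_n =>
            forall j, `|ratr (p.1 ord0 j) - y ord0 j| < ratr p.2) `<=` U])
        [set y : 'rV[R]_n |
            forall j, `|ratr (p.1 ord0 j) - y ord0 j| < ratr p.2].
Proof.
move=> oU; apply/seteqP; split=> [x Ux|x [p /= pU px]]; last exact: pU.
have /nbhs_ballP[e /= e0 xeU] : nbhs x U by exact: open_nbhs_nbhs.
have e20 : 0 < e / 2 by rewrite divr_gt0.
have [r /andP[r0 re]] : exists r : rat, (0 : R) < ratr r < e / 2.
  have [r] := rat_in_itvoo e20.
  by rewrite in_itv/= => rP; exists r.
have /choice[q qP] : forall j : 'I_n, exists q : rat,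
    `|ratr q - x ord0 j| < (ratr r : R).
  move=> j; have xr : x ord0 j < x ord0 j + ratr r by rewrite ltrDl.
  have [q] := rat_in_itvoo xr.
  rewrite in_itv/= => /andP[q1 q2]; exists q.
  by rewrite gtr0_norm ?subr_gt0// ltrBlDl.
exists (\row_j q j, r) => /=; last by move=> j; rewrite mxE.
move=> y yq; apply: xeU; split=> // i j; rewrite (ord1 i).
apply: (le_lt_trans (ler_distD (ratr (q j)) _ _)).
rewrite [e]splitr ltrD//; first by rewrite distrC; exact: (lt_trans (qP j)).
by have := yq j; rewrite mxE => /lt_trans; exact.
Qed.

Lemma measurable_fun_rV d (T : measurableType d) n (f : T -> 'rV[R]_n) :
  (forall j, measurable_fun [set: T] (fun t => f t ord0 j)) ->
  measurable_fun [set: T] f.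
Proof.
move=> mf; apply: (@measurability _ _ _ _ _ _ (@open 'rV[R]_n)) => //.
move=> _ [U oU <-]; rewrite setTI (open_rV_rational oU) preimage_bigcup.
rewrite bigcup_mkcond; apply: countable_bigcupT_measurable => [|p].
  exact: countableP.
case: ifP => // _.
rewrite (_ : _ @^-1` _ = \bigcap_(j in [set: 'I_n])
   ((fun t => f t ord0 j) @^-1` ball (ratr (p.1 ord0 j) : R) (ratr p.2))).
  apply: fin_bigcap_measurable => // j _; rewrite -[X in measurable X]setTI.
  by apply: mf => //; exact: measurable_ball.
apply/seteqP; split=> t /= h; first by move=> j _; exact: h.
by move=> j; exact: h.
Qed.

End measurable_rV.

Section lebesgue_rV.
Context (R : realType).
Local Open Scope ereal_scope.

Definition cons_rV n (p : measurableTypeR R * 'rV[R]_n) : 'rV[R]_n.+1 :=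
  row_mx (p.1)%:M p.2.

Definition uncons_rV n (x : 'rV[R]_n.+1) : measurableTypeR R * 'rV[R]_n :=
  ((lsubmx (x : 'rV_(1 + n))) ord0 ord0, rsubmx (x : 'rV_(1 + n))).

Lemma cons_rVK n : cancel (@cons_rV n) (@uncons_rV n).
Proof.
by move=> [a x]; rewrite /uncons_rV row_mxKl row_mxKr mxE eqxx.
Qed.

Lemma measurable_cons_rV n : measurable_fun [set: _] (@cons_rV n).
Proof.
apply: measurable_fun_rV => j.
case: (splitP (j : 'I_(1 + n))) => k jk.
  have -> : j = lshift n k by exact/val_inj.
  rewrite (_ : (fun _ => _) = fst)//; apply/funext => -[a x]/=.
  by rewrite [LHS](row_mxEl (a%:M : 'rV_1)) mxE (ord1 k) mulr1n.
have -> : j = rshift 1 k by exact/val_inj.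
have -> : (fun p => @cons_rV n p ord0 (rshift 1 k)) =
    (fun x : 'rV[R]_n => x ord0 k) \o snd.
  by apply/funext => -[a x]/=; rewrite [LHS](row_mxEr (a%:M : 'rV_1)).
by apply: measurableT_comp => //; exact: measurable_coord.
Qed.

Lemma measurable_uncons_rV n : measurable_fun [set: _] (@uncons_rV n).
Proof.
apply/measurable_fun_pairP; split.
  have -> : fst \o @uncons_rV n = fun x => x ord0 (lshift n ord0 : 'I_(1 + n)).
    by apply/funext => x /=; rewrite mxE.
  exact: measurable_coord.
apply: measurable_fun_rV => j.
have -> : (fun x => (snd \o @uncons_rV n) x ord0 j) =
    fun x => x ord0 (rshift 1 j : 'I_(1 + n)).
  by apply/funext => x /=; rewrite mxE.
exact: measurable_coord.
Qed.

#[local] Hint Resolve measurable_cons_rV : core.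

Section step.
Context n (mu : {sigma_finite_measure set 'rV[R]_n -> \bar R}).

Definition lebesgue_cons : set 'rV[R]_n.+1 -> \bar R :=
  pushforward (@lebesgue_measure R \x mu) (@cons_rV n).

Let lebesgue_cons0 : lebesgue_cons set0 = 0.
Proof. by rewrite /lebesgue_cons /pushforward preimage_set0 measure0. Qed.

Let lebesgue_cons_ge0 A : 0 <= lebesgue_cons A.
Proof. exact: measure_ge0. Qed.

Let lebesgue_cons_sigma_additive : semi_sigma_additive lebesgue_cons.
Proof. exact: measure_semi_sigma_additive. Qed.

HB.instance Definition _ := isMeasure.Build _ _ _ lebesgue_cons
  lebesgue_cons0 lebesgue_cons_ge0 lebesgue_cons_sigma_additive.

Let lebesgue_cons_sigma_finite : sigma_finite setT lebesgue_cons.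
Proof.
have /sigma_finiteP[F [TF ndF Foo]] := sigma_finiteT (@lebesgue_measure R).
have /sigma_finiteP[G [TG ndG Goo]] := sigma_finiteT mu.
exists (fun k => @uncons_rV n @^-1` (F k `*` G k)).
  rewrite -preimage_bigcup (_ : \bigcup_k (F k `*` G k) = setT)//.
  apply/seteqP; split=> // -[a x] _.
  have [i _ Fia] : (\bigcup_i F i) a by rewrite -TF.
  have [k _ Gkx] : (\bigcup_i G i) x by rewrite -TG.
  exists (maxn i k) => //; split=> /=.
  - by move: a Fia; exact/subsetPset/ndF/leq_maxl.
  - by move: x Gkx; exact/subsetPset/ndG/leq_maxr.
move=> k; have [mF Fk] := Foo k; have [mG Gk] := Goo k; split.
  rewrite -[X in measurable X]setTI; apply: measurable_uncons_rV => //.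
  exact: measurableX.
rewrite /lebesgue_cons /pushforward -comp_preimage.
rewrite (_ : _ \o _ = id); last by apply/funext => p; exact: cons_rVK.
by rewrite preimage_id product_measure1E// lte_mul_pinfty// ge0_fin_numE.
Qed.

HB.instance Definition _ := Measure_isSigmaFinite.Build _ _ _ lebesgue_cons
  lebesgue_cons_sigma_finite.

End step.

Fixpoint lebesgue_rV n : {sigma_finite_measure set 'rV[R]_n -> \bar R} :=
  if n is k.+1 then lebesgue_cons (lebesgue_rV k) else \d_(0%R : 'rV[R]_0).

End lebesgue_rV.

Section euclidean.
Context (R : realType) (n : nat).
Implicit Types x y : 'rV[R]_n.

Definition dot x y : R := \sum_i x ord0 i * y ord0 i.

(* The library norm on 'rV[R]_n is the sup norm, hence this one. *)
Definition enorm x : R := Num.sqrt (dot x x).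

Definition sphere : set 'rV[R]_n := [set x | enorm x = 1].

Definition closed_hemisphere (u : 'rV[R]_n) : set 'rV[R]_n :=
  [set v | sphere v /\ 0 <= dot u v].

(* omega_n *)
Definition ball_volume : R := fine (lebesgue_rV R n [set x | enorm x <= 1]).

Definition punctured_ball : set 'rV[R]_n := [set x | 0 < enorm x <= 1].

Definition normalize x : 'rV[R]_n := (enorm x)^-1 *: x.

Lemma measurable_enorm : measurable_fun [set: 'rV[R]_n] enorm.
Proof.
apply: measurableT_comp.
  by apply: continuous_measurable_fun; exact: sqrt_continuous.
by apply: measurable_sum => i; apply: measurable_funM; exact: measurable_coord.
Qed.

Lemma measurable_punctured_ball : measurable punctured_ball.
Proof.
have -> : punctured_ball = enorm @^-1` `]0, 1].
  by apply/seteqP; split=> x /=; rewrite in_itv.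
by rewrite -[X in measurable X]setTI; exact: measurable_enorm.
Qed.

Lemma measurable_normalize : measurable_fun [set: 'rV[R]_n] normalize.
Proof.
apply: measurable_fun_rV => j.
have -> : (fun x => normalize x ord0 j) =
    (fun x => enorm x `^ (-1) * x ord0 j).
  by apply/funext => x; rewrite mxE powR_inv1// sqrtr_ge0.
apply: measurable_funM; last exact: measurable_coord.
exact: (measurableT_comp (measurable_powR (-1)) measurable_enorm).
Qed.

#[local] Hint Resolve measurable_normalize : core.

(* cone_measure A is the volume of the cone {r u | 0 < r <= 1, u \in A `&` sphere}. *)
Definition cone_measure : set 'rV[R]_n -> \bar R :=
  pushforward (mrestr (lebesgue_rV R n) measurable_punctured_ball) normalize.

Let cone_measure0 : cone_measure set0 = 0%E.
Proof. exact: measure0. Qed.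

Let cone_measure_ge0 A : (0 <= cone_measure A)%E.
Proof. exact: measure_ge0. Qed.

Let cone_measure_sigma_additive : semi_sigma_additive cone_measure.
Proof. exact: measure_semi_sigma_additive. Qed.

HB.instance Definition _ := isMeasure.Build _ _ _ cone_measure
  cone_measure0 cone_measure_ge0 cone_measure_sigma_additive.

Definition borel_sphere_measure : set 'rV[R]_n -> \bar R :=
  mscale (n%:R%:nng : {nonneg R}) cone_measure.

HB.instance Definition _ := Measure.on borel_sphere_measure.

(* Spherical Lebesgue measure, defined on the completed sigma-algebra: the sets
   reverse_gauss K eta below are Lebesgue measurable but in general not Borel. *)
Definition sphere_measure :=
  @completed_measure_extension _ _ _ borel_sphere_measure.

HB.instance Definition _ := Measure.on sphere_measure.

End euclidean.
Arguments sphere {R n}.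
Arguments closed_hemisphere {R n}.
Arguments sphere_measure {R n}.

Section convex_bodies.
Context (R : realType) (n : nat).
Implicit Types (K eta Omega : set 'rV[R]_n) (u v : 'rV[R]_n) (q : R).

Definition support_fun K v : R := sup [set dot x v | x in K].

Definition radial_fun K u : R := sup [set l : R | K (l *: u)].

Definition radial_map K u : 'rV[R]_n := radial_fun K u *: u.

Definition support_hyperplane K v : set 'rV[R]_n :=
  [set x | dot x v = support_fun K v].

Definition wulff_shape Omega (h : 'rV[R]_n -> R) : set 'rV[R]_n :=
  [set x | forall v, Omega v -> dot x v <= h v].

Definition dual_volume q K : R :=
  n%:R^-1 * \int[sphere_measure]_(u in sphere) (radial_fun K u `^ q).

Definition normalized_dual_volume q K : R :=
  if q == 0 then
    expR ((n%:R * ball_volume R n)^-1 *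
      \int[sphere_measure]_(u in sphere) ln (radial_fun K u))
  else
    ((n%:R * ball_volume R n)^-1 *
      \int[sphere_measure]_(u in sphere) (radial_fun K u `^ q)) `^ q^-1.

(* The reverse radial Gauss image alpha^*_K(eta). *)
Definition reverse_gauss K eta : set 'rV[R]_n :=
  [set u | sphere u /\
     exists v, [/\ sphere v, eta v & support_hyperplane K v (radial_map K u)]].

(* A set function on R^n carried by the sphere; it is a Borel measure when K is a
   convex body with the origin in its interior, and [integral] accepts any set
   function, so that it can be integrated against directly. *)
Definition dual_curvature q K eta : \bar R :=
  ((n%:R^-1)%:E * \int[sphere_measure]_(u in reverse_gauss K eta)
     (radial_fun K u `^ q)%:E)%E.

Definition dual_curvature_integral q K Omega (f : 'rV[R]_n -> R) : R :=
  fine (\int[dual_curvature q K]_(v in Omega) (f v)%:E)%E.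

Definition log_family Omega (h0 f : 'rV[R]_n -> R) (h : R -> 'rV[R]_n -> R) :=
  exists (delta : R) (o : R -> 'rV[R]_n -> R),
  [/\ 0 < delta,
      forall v, Omega v -> h 0 v = h0 v,
      forall t, `|t| < delta ->
        [/\ {within Omega, continuous (h t)},
            {within Omega, continuous (o t)} &
            forall v, Omega v ->
              0 < h t v /\ ln (h t v) = ln (h0 v) + t * f v + o t v] &
      {uniform Omega, (fun t v => o t v / t) @ 0^' --> (fun=> 0 : R)}].

End convex_bodies.

(* Main.v *)
From HB Require Import structures.
Require Import Defs.
From mathcomp Require Import all_boot all_order all_algebra.
From mathcomp Require Import all_classical all_reals all_analysis.
From mathcomp Require Import measurable_realfun ring lra.
Import Order.TTheory GRing.Theory Num.Theory.
Import numFieldNormedType.Exports.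

(** Write [g_t(u)] for the maximum of [u.v / h_t(v)] over [v] in [Omega]. This
    is the gauge of the Wulff shape [[h_t]], so its radial function is
    [1 / g_t(u)], and [log rho_t(u)] is the minimum of [log h_t(v) - log (u.v)]
    over the [v] in [Omega] with [u.v > 0]. The family [h_t] therefore enters the minimised
    function only through the additive term [t f(v) + o(t, v)].

    Envelope theorem. If the minimum at [t = 0] is attained at a single [v],
    then [log rho_t(u)] is differentiable at [t = 0] with derivative [f(v)]
    ([log_radial_derive]): comparing the minima at [0] and at [t] brackets the
    increment between the values of [t f + o(t, .)] at the two minimisers, and
    by compactness the minimiser for [t] approaches [v]. The same comparison
    bounds the increment by [M |t|] uniformly in [u]
    ([log_radial_lipschitz]).

    Uniqueness almost everywhere. A unit vector [v] that supports [[h_0]] at the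
    radial point of [u] yields the subgradient [v / h(v)] of the convex function
    [g_0] at [u], with [h] the support function ([subgradient_support]), so it
    suffices that subgradients are unique for almost every [u]. Two subgradients
    that differ in the [i]-th coordinate force a kink of [g_0] along the line
    through [u] in direction [e_i]. The points with a kink in direction [e_i] of
    a prescribed rational slope and size form a closed cone that meets every
    such line at most once, hence a null set by Fubini ([lebesgue_rV_lines0],
    [sphere_measure_kinks]); there are countably many of these cones
    ([subgradient_unique]).

    Outside this null set the minimiser defines the radial Gauss map [alpha],
    which is measurable, and the reverse radial Gauss image of a Borel set is
    its preimage under [alpha]. The dual curvature measure of order [q] is thus
    the push-forward under [alpha] of the spherical measure with density
    [rho_0^q / n], so that the integral of [f] against it is the integral of
    [(f o alpha) rho_0^q / n] over the sphere ([dual_curvature_integralE]).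

    Finally the integrals of [rho_t^q = exp (q log rho_t)] and of [log rho_t]
    are differentiated under the integral sign by dominated convergence
    ([derive_under_integral]), and the statement on [log V_q] follows by the
    chain rule. *)

Set Implicit Arguments.
Unset Strict Implicit.
Unset Printing Implicit Defensive.

Local Open Scope classical_set_scope.
Local Open Scope ring_scope.

(** * The Euclidean product and the unit sphere *)

Section dot_product.
Context (R : realType) (n : nat).
Implicit Types x y z v : 'rV[R]_n.

Lemma dotC x y : dot x y = dot y x.
Proof. by apply: eq_bigr => i _; rewrite mulrC. Qed.

Lemma dotDl x y z : dot (x + y) z = dot x z + dot y z.
Proof.
by rewrite /dot -big_split; apply: eq_bigr => i _; rewrite mxE mulrDl.
Qed.

Lemma dotZl (a : R) x y : dot (a *: x) y = a * dot x y.
Proof. by rewrite /dot big_distrr; apply: eq_bigr => i _ /=; rewrite mxE mulrA. Qed.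

Lemma dotBl x y z : dot (x - y) z = dot x z - dot y z.
Proof. by rewrite -scaleN1r dotDl dotZl mulN1r. Qed.

Lemma dotZr (a : R) x y : dot x (a *: y) = a * dot x y.
Proof. by rewrite dotC dotZl dotC. Qed.

Lemma dot_delta x i : dot x (delta_mx ord0 i) = x ord0 i.
Proof.
rewrite /dot (bigD1 i)//= big1 => [|j ji]; rewrite mxE eqxx/=.
  by rewrite eqxx mulr1 addr0.
by rewrite (negbTE ji) mulr0.
Qed.

Lemma dot_ge0 x : 0 <= dot x x.
Proof. by apply: sumr_ge0 => i _; rewrite -expr2 sqr_ge0. Qed.

Lemma sqr_coord_le x i : (x ord0 i) ^+ 2 <= dot x x.
Proof.
rewrite /dot (bigD1 i)//= expr2 lerDl.
by apply: sumr_ge0 => j _; rewrite -expr2 sqr_ge0.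
Qed.

Lemma enormZ (a : R) x : enorm (a *: x) = `|a| * enorm x.
Proof.
by rewrite /enorm dotZl dotZr mulrA -expr2 sqrtrM ?sqr_ge0// sqrtr_sqr.
Qed.

Lemma enorm0 : enorm (0 : 'rV[R]_n) = 0.
Proof. by rewrite -(scale0r 0) enormZ normr0 mul0r. Qed.

Lemma enorm_eq0 x : enorm x = 0 -> x = 0.
Proof.
move=> /eqP; rewrite sqrtr_eq0 => x0; apply/rowP => i; rewrite mxE.
apply/eqP; rewrite -sqrf_eq0 eq_le sqr_ge0 andbT.
exact: le_trans (sqr_coord_le x i) x0.
Qed.

Lemma sphere_dot x : sphere x -> dot x x = 1.
Proof.
by move=> /(congr1 (fun r => r ^+ 2)); rewrite sqr_sqrtr ?dot_ge0// expr1n.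
Qed.

Lemma sphere_neq0 x : sphere x -> x != 0.
Proof.
move=> /sphere_dot dx; apply/eqP => x0; move: dx; rewrite x0 /dot big1.
  by move/eqP; rewrite eq_sym oner_eq0.
by move=> i _; rewrite mxE mul0r.
Qed.

Lemma sphere_normalize x : x != 0 -> sphere (normalize x).
Proof.
move=> x0; rewrite /sphere/= /normalize enormZ.
have ne : enorm x != 0 by apply: contra x0 => /eqP/enorm_eq0 ->.
by rewrite ger0_norm ?invr_ge0 ?sqrtr_ge0// mulVf.
Qed.

Lemma coord_le_norm x i : `|x ord0 i| <= `|x|.
Proof.
rewrite [leRHS]mx_normrE; apply/bigmax_geP; right => /=.
by exists (ord0, i).
Qed.

Lemma norm_le_coord x (c : R) :
  0 <= c -> (forall i, `|x ord0 i| <= c) -> `|x| <= c.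
Proof.
move=> c0 xc; rewrite [leLHS]mx_normrE; apply/bigmax_leP => /=.
by split => // -[i j] _ /=; rewrite (ord1 i).
Qed.

Lemma sphere_coord_le1 v i : sphere v -> `|v ord0 i| <= 1.
Proof.
move=> /sphere_dot v1; rewrite -sqrtr_sqr -[leRHS]sqrtr1 ler_sqrt// -v1.
exact: sqr_coord_le.
Qed.

(** A crude substitute for the Cauchy-Schwarz inequality: the norm on row
    vectors is the sup norm, and only the finiteness of the constant matters. *)
Lemma dot_sphere_le x v : sphere v -> `|dot x v| <= n%:R * `|x|.
Proof.
move=> Sv; apply: le_trans (ler_norm_sum _ _ _) _.
apply: (@le_trans _ _ (\sum_(i < n) `|x|)); last first.
  by rewrite sumr_const card_ord mulr_natl.
apply: ler_sum => i _; rewrite normrM -[leRHS]mulr1.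
by apply: ler_pM => //; [exact: coord_le_norm|exact: sphere_coord_le1].
Qed.

Lemma continuous_dot x : continuous (dot x).
Proof.
apply: continuous_big => [|i _]; first exact: add_continuous.
move=> v; apply: continuousM; first exact: cst_continuous.
exact: coord_continuous.
Qed.

Lemma continuous_dot_diag : continuous (fun x : 'rV[R]_n => dot x x).
Proof.
apply: continuous_big => [|i _]; first exact: add_continuous.
by move=> v; apply: continuousM; exact: coord_continuous.
Qed.

Lemma compact_sphere : compact (@sphere R n).
Proof.
apply: bounded_closed_compact.
  exists 1; split => // M M1 x Sx; apply: (le_trans _ (ltW M1)).
  by apply: norm_le_coord => // i; exact: sphere_coord_le1.
have -> : @sphere R n = (fun x => dot x x) @^-1` [set 1].
  apply/seteqP; split => x /=; first exact: sphere_dot.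
  by rewrite /sphere/= /enorm => ->; rewrite sqrtr1.
apply: preimage_closed; last exact: closed_eq.
by move=> x _; exact: continuous_dot_diag.
Qed.

End dot_product.

(** * The gauge of a Wulff shape *)

Section gauge_def.
Context (R : realType) (n : nat).

(** For the Wulff shape [K] of [h] this is the gauge of [K], so [1 / gauge] is
    its radial function; as a function of [x] it is a maximum of linear forms. *)
Definition gauge (Omega : set 'rV[R]_n) (h : 'rV[R]_n -> R) (x : 'rV[R]_n) : R :=
  sup [set dot x v / h v | v in Omega].

End gauge_def.

Section gauge.
Context (R : realType) (n : nat) (Omega : set 'rV[R]_n) (h : 'rV[R]_n -> R).
Hypothesis Omega0 : Omega !=set0.
Hypothesis cOmega : compact Omega.
Hypothesis sOmega : Omega `<=` sphere.
Hypothesis ch : {within Omega, continuous h}.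
Hypothesis h_gt0 : forall v, Omega v -> 0 < h v.

Lemma gauge_attained x :
  exists2 v, Omega v & gauge Omega h x = dot x v / h v /\
    forall w, Omega w -> dot x w / h w <= gauge Omega h x.
Proof.
have c : {within Omega, continuous (fun v => dot x v / h v)}.
  rewrite continuous_subspace_in => v /set_mem Ov; apply: cvgM.
    exact: (continuous_subspaceT (@continuous_dot _ _ x)).
  by apply: cvgV; [rewrite gt_eqF// h_gt0|exact: ch].
have [v /set_mem Ov vm] := compact_EVT_max Omega0 cOmega c.
have ub : ubound [set dot x v / h v | v in Omega] (dot x v / h v).
  by move=> _ [w Ow <-]; apply: vm; exact/mem_set.
have E : gauge Omega h x = dot x v / h v.
  apply/eqP; rewrite eq_le; apply/andP; split.
    by apply: ge_sup => //; exists (dot x v / h v), v.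
  by apply: ub_le_sup; [exists (dot x v / h v)|exists v].
exists v => //; split => // w Ow; rewrite E; exact: vm (mem_set Ow).
Qed.

Lemma gauge_ge x v : Omega v -> dot x v / h v <= gauge Omega h x.
Proof. by have [w _ [_ H]] := gauge_attained x; exact: H. Qed.

Lemma gauge_le x (c : R) :
  (forall v, Omega v -> dot x v / h v <= c) -> gauge Omega h x <= c.
Proof. by have [w Ow [-> _]] := gauge_attained x; exact. Qed.

Lemma gaugeZ (a : R) x : 0 < a -> gauge Omega h (a *: x) = a * gauge Omega h x.
Proof.
move=> a0; apply/eqP; rewrite eq_le; apply/andP; split.
  by apply: gauge_le => v Ov; rewrite dotZl -mulrA ler_pM2l// gauge_ge.
have [v Ov [-> _]] := gauge_attained x.
by rewrite mulrA -dotZl gauge_ge.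
Qed.

Lemma support_bounded_below :
  exists2 m : R, 0 < m & forall v, Omega v -> m <= h v.
Proof.
have [v /set_mem Ov vm] := compact_EVT_min Omega0 cOmega ch.
by exists (h v) => [|w Ow]; [exact: h_gt0|exact: vm (mem_set Ow)].
Qed.

(** A maximum of linear forms with bounded coefficients; the constant uses
    [n.+1] rather than [n] only to be visibly positive. *)
Lemma gauge_lipschitz : exists2 c : R, 0 < c &
  forall x y, `|gauge Omega h x - gauge Omega h y| <= c * `|x - y|.
Proof.
have [m m0 mh] := support_bounded_below.
have c0 : 0 < n.+1%:R / m by rewrite divr_gt0.
exists (n.+1%:R / m) => //.
suff H x y : gauge Omega h x - gauge Omega h y <= n.+1%:R / m * `|x - y|.
  by move=> x y; rewrite ler_norml H andbT lerNl opprB distrC H.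
rewrite lerBlDl; apply: gauge_le => v Ov.
rewrite -[x in dot x v](addrNK y) addrC dotDl mulrDl lerD ?gauge_ge//.
have hv := h_gt0 Ov.
rewrite ler_pdivrMr//; apply: (le_trans (ler_norm _)).
apply: (le_trans (dot_sphere_le _ (sOmega Ov))).
rewrite mulrAC ler_wpM2r// mulrAC ler_pdivlMr// ler_pM ?ler0n ?(ltW m0)//.
  by rewrite ler_nat.
exact: mh.
Qed.

Lemma continuous_gauge : continuous (gauge Omega h).
Proof.
have [c c0 gl] := gauge_lipschitz.
move=> x; apply/(@cvgrPdist_le _ _ _ _ (nbhs_filter x)) => e e0.
apply/nbhs_ballP.
exists (e / c); first by rewrite /= divr_gt0.
move=> y; rewrite -ball_normE /= => /ltW xy.
by apply: le_trans (gl _ _) _; rewrite mulrC -ler_pdivlMr.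
Qed.

Section positive.
Hypothesis hemi : forall u, sphere u -> ~ (Omega `<=` closed_hemisphere u).

(** Otherwise [Omega] would lie in the closed hemisphere of the opposite
    direction. *)
Lemma exists_dot_gt0 x : x != 0 -> exists2 v, Omega v & 0 < dot x v.
Proof.
move=> x0; have Sx := sphere_normalize x0.
have e0 : 0 < enorm x.
  rewrite lt_neqAle sqrtr_ge0 andbT eq_sym.
  by apply: contra x0 => /eqP/enorm_eq0 ->.
have SNx : sphere (- normalize x).
  by rewrite /sphere/= -scaleN1r enormZ normrN1 mul1r.
have /existsNP[v /not_implyP[Ov Hv]] := hemi SNx; exists v => //.
rewrite ltNge; apply/negP => xv; apply: Hv; split; first exact: sOmega.
by rewrite -scaleN1r !dotZl mulN1r oppr_ge0 pmulr_rle0// invr_gt0.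
Qed.

Lemma gauge_gt0 x : x != 0 -> 0 < gauge Omega h x.
Proof.
move=> /exists_dot_gt0[v Ov xv].
by apply: lt_le_trans (gauge_ge _ Ov); rewrite divr_gt0// h_gt0.
Qed.

Lemma gauge_sphere_ge :
  exists2 c : R, 0 < c & forall u, sphere u -> c <= gauge Omega h u.
Proof.
have [v Ov] := Omega0.
have S0 : @sphere R n !=set0 by exists v; exact: sOmega.
have [u /set_mem Su um] := compact_EVT_min S0 (@compact_sphere R n)
  (continuous_subspaceT continuous_gauge).
exists (gauge Omega h u) => [|w Sw]; first exact/gauge_gt0/sphere_neq0.
exact: um (mem_set Sw).
Qed.

Lemma wulff_shapeE x : wulff_shape Omega h x <-> gauge Omega h x <= 1.
Proof.
split => [Kx|gx v Ov].
  by apply: gauge_le => v Ov; rewrite ler_pdivrMr ?h_gt0// mul1r; exact: Kx.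
rewrite -[leRHS]mul1r -ler_pdivrMr ?h_gt0//.
exact: le_trans (gauge_ge _ Ov) gx.
Qed.

Lemma radial_fun_wulff u : u != 0 ->
  radial_fun (wulff_shape Omega h) u = (gauge Omega h u)^-1.
Proof.
move=> /gauge_gt0 g0; have gi0 : 0 < (gauge Omega h u)^-1 by rewrite invr_gt0.
have ub : ubound [set l : R | wulff_shape Omega h (l *: u)] (gauge Omega h u)^-1.
  move=> l /=; rewrite wulff_shapeE; have [l0|l0 _] := ltP 0 l.
    by rewrite gaugeZ// -ler_pdivlMr// mul1r.
  exact: le_trans l0 (ltW gi0).
have mem : wulff_shape Omega h ((gauge Omega h u)^-1 *: u).
  by rewrite wulff_shapeE gaugeZ// mulVf// gt_eqF.
apply/eqP; rewrite eq_le; apply/andP; split.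
  by apply: ge_sup => //; exists (gauge Omega h u)^-1.
by apply: ub_le_sup => //; exists (gauge Omega h u)^-1.
Qed.

End positive.
End gauge.

(** * Subgradients and the kinks of a gauge *)

Section subgradient.
Context (R : realType) (n : nat).
Implicit Types (g : 'rV[R]_n -> R) (x u p : 'rV[R]_n).

(** For a positively homogeneous convex [g], these are the subgradients at
    [u]. *)
Definition subgradient g u p := (forall y, dot p y <= g y) /\ dot p u = g u.

(** Along the [i]-th coordinate line through [x], the function [g] stays above
    a wedge of slopes [ratr q - 1 / k.+1] and [ratr q + 1 / k.+1]: for convex
    [g] both slopes lie between the left and the right derivative of [g] along
    that line. Restricting to rational [q] and to [1 / k.+1] leaves countably
    many sets, and non-strict inequalities make each of them closed. *)
Definition coord_kink g (i : 'I_n) (q : rat) (k : nat) : set 'rV[R]_n :=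
  [set x | forall s : R,
    g x + k.+1%:R^-1 * `|s| <= g (x + s *: delta_mx ord0 i) - ratr q * s].

Definition kinks g : set 'rV[R]_n :=
  \bigcup_(t in [set: 'I_n * rat * nat]) coord_kink g t.1.1 t.1.2 t.2.

Lemma subgradient_line g u p i s : subgradient g u p ->
  g u + s * p ord0 i <= g (u + s *: delta_mx ord0 i).
Proof.
by move=> [pg pu]; rewrite -pu -dot_delta -dotZr dotC [dot p (_ *: _)]dotC
  -dotDl dotC pg.
Qed.

(** If two subgradients differ in the [i]-th coordinate, a rational [q]
    strictly between these coordinates exhibits a kink in direction [i]. *)
Lemma subgradient_unique g u p p' :
  ~ kinks g u -> subgradient g u p -> subgradient g u p' -> p = p'.
Proof.
move=> Nu.
suff H p1 p2 i : subgradient g u p1 -> subgradient g u p2 ->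
    p1 ord0 i <= p2 ord0 i.
  by move=> sp sp'; apply/rowP => i; apply/eqP; rewrite eq_le !H.
move=> sp2 sp1; rewrite leNgt; apply/negP => p12; apply: Nu.
have [q] := rat_in_itvoo p12; rewrite in_itv/= => /andP[p1q qp2].
pose e := Num.min (ratr q - p2 ord0 i) (p1 ord0 i - ratr q).
have e0 : 0 < e by rewrite lt_min !subr_gt0 p1q.
have [k _ ke] := near_infty_natSinv_lt (PosNum e0).
have {}ke : k.+1%:R^-1 < e by exact: (ke k (leqnn k)).
have /andP[k1 k2] : (k.+1%:R^-1 <= ratr q - p2 ord0 i) &&
    (k.+1%:R^-1 <= p1 ord0 i - ratr q).
  by rewrite -le_min ltW.
exists (i, q, k) => // s /=; rewrite lerBrDr.
have [s0|s0] := leP 0 s.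
  apply: le_trans (subgradient_line i s sp2).
  by rewrite ger0_norm// -addrA lerD2l -mulrDl mulrC ler_wpM2l// -lerBrDr.
apply: le_trans (subgradient_line i s sp1).
rewrite ltr0_norm// -addrA lerD2l mulrN -mulNr -mulrDl mulrC.
rewrite ler_wnM2l ?(ltW s0)//.
by rewrite addrC lerBrDr -lerBrDl.
Qed.

Lemma closed_coord_kink g i q k : continuous g -> closed (coord_kink g i q k).
Proof.
move=> cg.
have -> : coord_kink g i q k = \bigcap_(s in [set: R])
   (fun x => g (x + s *: delta_mx ord0 i) - g x) @^-1`
     [set r | k.+1%:R^-1 * `|s| + ratr q * s <= r].
  rewrite /coord_kink; move: (k.+1%:R^-1) => c; apply/seteqP.
  split=> x /= H s; last by have /= := H s I; lra.
  by move=> _ /=; have := H s; lra.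
apply: closed_bigI => s _; apply: preimage_closed; last exact: closed_ge.
move=> x _; apply: continuousB; last exact: cg.
apply: continuous_comp; last exact: cg.
by apply: continuousD; [exact: cvg_id|exact: cst_continuous].
Qed.

(** After subtraction of the slope [ratr q], each of two distinct such points
    would have a strictly smaller value than the other. *)
Lemma coord_kink_line g i q k x s :
  coord_kink g i q k x -> coord_kink g i q k (x + s *: delta_mx ord0 i) -> s = 0.
Proof.
move=> /(_ s) H1 /(_ (- s)) H2; move: H1 H2.
rewrite -addrA -scalerDl subrr scale0r addr0 normrN => H1 H2.
have : k.+1%:R^-1 * `|s| <= 0.
  by move: H1 H2; move: (k.+1%:R^-1) => c; lra.
by rewrite pmulr_rle0 ?invr_gt0// normr_le0 => /eqP.
Qed.

Lemma coord_kinkZ g i q k x (a : R) :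
  (forall b y, 0 < b -> g (b *: y) = b * g y) -> 0 < a ->
  coord_kink g i q k x -> coord_kink g i q k (a *: x).
Proof.
move=> gZ a0 kx s.
have -> : a *: x + s *: delta_mx ord0 i = a *: (x + (s / a) *: delta_mx ord0 i).
  by rewrite scalerDr scalerA mulrC divfK ?gt_eqF.
have := kx (s / a); rewrite -(ler_pM2l a0) !gZ// => H.
have -> : `|s| = a * `|s / a|.
  by rewrite normrM normfV (gtr0_norm a0) mulrC divfK ?gt_eqF.
have E : ratr q * s = a * (ratr q * (s / a)) :> R.
  by rewrite mulrCA mulrC [a * _]mulrC divfK// ?gt_eqF// mulrC.
by rewrite E mulrCA -mulrDr -mulrBr.
Qed.

End subgradient.

(** * Outer unit normals of a Wulff shape *)

Section support.
Context (R : realType) (n : nat) (Omega : set 'rV[R]_n) (h : 'rV[R]_n -> R).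
Hypothesis Omega0 : Omega !=set0.
Hypothesis cOmega : compact Omega.
Hypothesis sOmega : Omega `<=` sphere.
Hypothesis ch : {within Omega, continuous h}.
Hypothesis h_gt0 : forall v, Omega v -> 0 < h v.
Hypothesis hemi : forall u, sphere u -> ~ (Omega `<=` closed_hemisphere u).

Notation g := (gauge Omega h).
Notation K := (wulff_shape Omega h).

(** Bounds the suprema that define the support function. *)
Lemma wulff_shape_bounded : exists M : R, forall x, K x -> `|x| <= M.
Proof.
have [c c0 gc] := gauge_sphere_ge Omega0 cOmega sOmega ch h_gt0 hemi.
exists c^-1 => x; rewrite (wulff_shapeE Omega0 cOmega ch h_gt0) => gx.
have [->|x0] := eqVneq x 0; first by rewrite normr0 invr_ge0 ltW.
have e0 : 0 < enorm x.
  rewrite lt_neqAle sqrtr_ge0 andbT eq_sym.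
  by apply: contra x0 => /eqP/enorm_eq0 ->.
have xE : x = enorm x *: normalize x by rewrite scalerA mulfV ?scale1r// gt_eqF.
have ex : enorm x <= c^-1.
  rewrite -[leRHS]mul1r ler_pdivlMr//; apply: le_trans gx.
  rewrite {2}xE (gaugeZ Omega0 cOmega ch h_gt0)// ler_pM2l//.
  exact/gc/sphere_normalize.
apply: norm_le_coord => [|i]; first by rewrite invr_ge0 ltW.
apply: le_trans ex; rewrite -sqrtr_sqr ler_sqrt ?dot_ge0//.
exact: sqr_coord_le.
Qed.

Lemma gauge0 : g 0 = 0.
Proof.
have [v Ov [-> _]] := gauge_attained Omega0 cOmega ch h_gt0 0.
by rewrite -[X in dot X](scale0r 0) dotZl !mul0r.
Qed.

Lemma subgradient_normal u v : Omega v -> g u = dot u v / h v ->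
  subgradient g u ((h v)^-1 *: v).
Proof.
move=> Ov gu; split => [y|]; rewrite dotZl dotC mulrC ?gu//.
exact: gauge_ge.
Qed.

(** The inequality [dot y v <= support_fun K v * g y] says that the point
    [y / g y] of [K] lies below the support hyperplane; it becomes an equality
    at [u] because that hyperplane touches [K] at the radial point of [u]. *)
Lemma subgradient_support u v : u != 0 -> sphere v ->
  support_hyperplane K v (radial_map K u) ->
  0 < support_fun K v /\ subgradient g u ((support_fun K v)^-1 *: v).
Proof.
move=> u0 Sv uv; set H := support_fun K v.
have g0 := gauge_gt0 Omega0 cOmega sOmega ch h_gt0 hemi.
have [M KM] := wulff_shape_bounded.
have hs x : K x -> dot x v <= H.
  move=> Kx; apply: ub_le_sup; last by exists x.
  exists (n%:R * M) => _ [y Ky <-]; apply: le_trans (ler_norm _) _.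
  by apply: le_trans (dot_sphere_le _ Sv) _; rewrite ler_wpM2l// KM.
have gH y : dot y v <= H * g y.
  have [->|y0] := eqVneq y 0.
    by rewrite gauge0 mulr0 -[X in dot X](scale0r 0) dotZl mul0r.
  rewrite -ler_pdivrMr ?g0// mulrC -dotZl; apply: hs.
  rewrite (wulff_shapeE Omega0 cOmega ch h_gt0) (gaugeZ Omega0 cOmega ch h_gt0).
    by rewrite mulVf// gt_eqF ?g0.
  by rewrite invr_gt0 g0.
have H0 : 0 < H.
  have := gH v; rewrite sphere_dot// => /(lt_le_trans ltr01).
  by rewrite pmulr_lgt0// g0 ?sphere_neq0.
split => //; split => [y|]; first by rewrite dotZl dotC ler_pdivrMl.
move: uv; rewrite /support_hyperplane/= /radial_map -/H.
rewrite (radial_fun_wulff Omega0 cOmega sOmega ch h_gt0 hemi)// !dotZl => uv.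
have E : dot u v = g u * H by rewrite -uv mulVKf// gt_eqF ?g0.
by rewrite dotC E mulrC mulfK// gt_eqF.
Qed.

Lemma support_hyperplane_radial u v : u != 0 -> Omega v -> g u = dot u v / h v ->
  support_hyperplane K v (radial_map K u).
Proof.
move=> u0 Ov gu.
have g0 := gauge_gt0 Omega0 cOmega sOmega ch h_gt0 hemi u0.
rewrite /support_hyperplane/= /radial_map.
rewrite (radial_fun_wulff Omega0 cOmega sOmega ch h_gt0 hemi)// dotZl.
have -> : (g u)^-1 * dot u v = h v.
  by rewrite -[dot u v](divfK (lt0r_neq0 (h_gt0 Ov))) -gu mulKf// gt_eqF.
have ub : ubound [set dot x v | x in K] (h v) by move=> _ [x Kx <-]; exact: Kx.
have mem : [set dot x v | x in K] (h v).
  exists ((g u)^-1 *: u).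
    rewrite (wulff_shapeE Omega0 cOmega ch h_gt0) (gaugeZ Omega0 cOmega ch h_gt0).
      by rewrite mulVf// gt_eqF ?g0.
    by rewrite invr_gt0 g0.
  by rewrite dotZl -[dot u v](divfK (lt0r_neq0 (h_gt0 Ov))) -gu mulKf// gt_eqF.
apply/eqP; rewrite eq_le; apply/andP; split.
  by apply: ub_le_sup => //; exists (h v).
by apply: ge_sup => //; exists (h v).
Qed.

(** Here [w] ranges over the whole sphere: away from the kinks, the reverse
    radial Gauss image is decided by the single normal that [Omega] provides. *)
Lemma normal_unique u v w : u != 0 -> ~ kinks g u -> Omega v ->
  g u = dot u v / h v -> sphere w ->
  support_hyperplane K w (radial_map K u) -> w = v.
Proof.
move=> u0 Nu Ov gu Sw uw.
have [H0 sw] := subgradient_support u0 Sw uw.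
have E := subgradient_unique Nu sw (subgradient_normal Ov gu).
have wE : w = (support_fun K w / h v) *: v.
  by rewrite -scalerA -E scalerA mulfV ?scale1r// gt_eqF.
have := Sw; rewrite {1}wE /sphere/= enormZ (sOmega Ov) mulr1.
by rewrite gtr0_norm ?divr_gt0 ?h_gt0// => c1; rewrite wE c1 scale1r.
Qed.

End support.

(** * Null sets and the volume of the ball *)

Section borel.
Context (R : realType) (n : nat).

Lemma measurable_open_rV (U : set 'rV[R]_n) : open U -> measurable U.
Proof. by move=> oU; apply: sub_sigma_algebra. Qed.

Lemma measurable_closed_rV (F : set 'rV[R]_n) : closed F -> measurable F.
Proof. move=> cF; rewrite -(setCK F); apply: measurableC.
by apply: measurable_open_rV; rewrite openC. Qed.

Lemma within_continuous_measurable_rV (D : set 'rV[R]_n) (f : 'rV[R]_n -> R) :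
  measurable D -> {within D, continuous f} -> measurable_fun D f.
Proof.
move=> mD /continuousP cf; apply: (measurability _ (RGenOpens.measurableE R)).
move=> _ [_ [a [b ->] <-]].
have /open_subspaceP [V oV VD] :=
  cf _ (@interval_open R (BRight a) (BLeft b) isT isT).
by rewrite setIC -VD; apply: measurableI => //; exact: measurable_open_rV.
Qed.

Lemma continuous_measurable_rV (D : set 'rV[R]_n) (f : 'rV[R]_n -> R) :
  measurable D -> continuous f -> measurable_fun D f.
Proof.
by move=> mD cf; apply: within_continuous_measurable_rV => //;
  exact: continuous_subspaceT.
Qed.

End borel.

Section lebesgue_rV_facts.
Context (R : realType).

Lemma cons_rV0 n (a : measurableTypeR R) (y : 'rV[R]_n) :
  cons_rV (a, y) ord0 (lshift n ord0 : 'I_(1 + n)) = a.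
Proof. by rewrite [LHS](row_mxEl (a%:M : 'rV_1)) mxE mulr1n. Qed.

Lemma cons_rVS n (a : measurableTypeR R) (y : 'rV[R]_n) (k : 'I_n) :
  cons_rV (a, y) ord0 (rshift 1 k : 'I_(1 + n)) = y ord0 k.
Proof. by rewrite [LHS](row_mxEr (a%:M : 'rV_1)). Qed.

Lemma cons_rV_line0 n (a s : measurableTypeR R) (y : 'rV[R]_n) :
  cons_rV (a + s, y) =
  cons_rV (a, y) + s *: delta_mx ord0 (lshift n ord0 : 'I_(1 + n)).
Proof.
apply/rowP => j; rewrite [RHS]mxE [X in _ = _ + X]mxE [X in _ * X]mxE eqxx/=.
case: (splitP (j : 'I_(1 + n))) => k jk.
  have -> : j = lshift n k by exact/val_inj.
  by rewrite (ord1 k) !cons_rV0 eqxx mulr1.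
have -> : j = rshift 1 k by exact/val_inj.
by rewrite !cons_rVS eq_rlshift mulr0 addr0.
Qed.

Lemma cons_rV_lineS n (a s : measurableTypeR R) (y : 'rV[R]_n) (i : 'I_n) :
  cons_rV (a, y + s *: delta_mx ord0 i) =
  cons_rV (a, y) + s *: delta_mx ord0 (rshift 1 i : 'I_(1 + n)).
Proof.
apply/rowP => j; rewrite [RHS]mxE [X in _ = _ + X]mxE [X in _ * X]mxE eqxx/=.
case: (splitP (j : 'I_(1 + n))) => k jk.
  have -> : j = lshift n k by exact/val_inj.
  by rewrite (ord1 k) !cons_rV0 eq_lrshift mulr0 addr0.
have -> : j = rshift 1 k by exact/val_inj.
by rewrite !cons_rVS !mxE eq_rshift.
Qed.

(** By Fubini, slicing along the [i]-th coordinate: the slices have at most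
    one point. The measure is built one coordinate at a time, so the recursion
    peels coordinates off until the [i]-th one comes first. *)
Lemma lebesgue_rV_lines0 n (A : set 'rV[R]_n) (i : 'I_n) : measurable A ->
  (forall x s, A x -> A (x + s *: delta_mx ord0 i) -> s = 0) ->
  lebesgue_rV R n A = 0%E.
Proof.
elim: n A i => [A []//|n IH] A i mA Ai.
have mB : measurable (@cons_rV R n @^-1` A).
  by rewrite -[X in measurable X]setTI; exact: measurable_cons_rV.
rewrite /lebesgue_rV /= -/(lebesgue_rV R n) /lebesgue_cons /pushforward.
case: (splitP (i : 'I_(1 + n))) => k ik.
  have {}ik : i = (lshift n ord0 : 'I_(1 + n)).
    by apply/val_inj; rewrite /= ik (ord1 k).
  rewrite (product_measure_unique
    (m' := (@lebesgue_measure R \x^ lebesgue_rV R n)%E))//.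
    rewrite /product_measure2; apply: integral0_eq => y _ /=.
    have [->|/set0P[a aA]] := eqVneq (ysection (@cons_rV R n @^-1` A) y) set0.
      by rewrite measure0.
    rewrite (_ : ysection _ _ = [set a]) ?lebesgue_measure_set1//.
    apply/seteqP; split=> [b bA|_ -> //]; apply/eqP.
    rewrite -subr_eq0; apply/eqP; move/ysectionP: aA => /= aA.
    apply: (Ai _ _ aA); rewrite ik -cons_rV_line0 addrC subrK.
    by move/ysectionP: bA.
  by move=> X Y mX mY; exact: product_measure2E.
have {}ik : i = (rshift 1 k : 'I_(1 + n)) by apply/val_inj; rewrite /= ik.
rewrite /product_measure1; apply: integral0_eq => a _ /=.
apply: (IH _ k); first exact: measurable_xsection.
move=> x s /xsectionP /= H1 /xsectionP /= H2.
apply: (Ai _ s H1); rewrite ik -cons_rV_lineS; exact: H2.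
Qed.

Definition box n (r : R) : set 'rV[R]_n := [set x | forall i, `|x ord0 i| <= r].

Lemma measurable_box n r : measurable (@box n r).
Proof.
have -> : @box n r = \bigcap_(i in [set: 'I_n])
    (fun x : 'rV[R]_n => x ord0 i) @^-1` `[- r, r].
  apply/seteqP; split=> x /=; last first.
    by move=> H i; have /= := H i I; rewrite in_itv/= ler_norml.
  by move=> H i _ /=; rewrite in_itv/= -ler_norml; exact: H.
apply: fin_bigcap_measurable => // i _; rewrite -[X in measurable X]setTI.
exact: measurable_coord.
Qed.

Lemma lebesgue_rV_box n (r : R) : 0 < r ->
  lebesgue_rV R n (box r) = ((r *+ 2) ^+ n)%:E.
Proof.
move=> r0; elim: n => [|n IH].
  rewrite /lebesgue_rV /= diracE mem_set//; by move=> [].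
rewrite /lebesgue_rV /= -/(lebesgue_rV R n) /lebesgue_cons /pushforward.
have -> : @cons_rV R n @^-1` (box r) = `[- r, r]%classic `*` box r.
  apply/seteqP; split=> [[a y] H|[a y] [/= H1 H2] i].
    split=> /= [|k].
      have := H (lshift n ord0 : 'I_(1 + n)).
      by rewrite cons_rV0 in_itv/= -ler_norml.
    by have := H (rshift 1 k : 'I_(1 + n)); rewrite cons_rVS.
  case: (splitP (i : 'I_(1 + n))) => k ik.
    have -> : i = lshift n k by exact/val_inj.
    by rewrite (ord1 k) cons_rV0 ler_norml; move: H1; rewrite in_itv.
  have -> : i = rshift 1 k by exact/val_inj.
  by rewrite cons_rVS; exact: H2.
rewrite product_measure1E//; last exact: measurable_box.
have L : lebesgue_measure `[- r, r] = (r *+ 2)%:E.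
  by rewrite lebesgue_measure_itv/= lte_fin gtrN// -EFinD opprK mulr2n.
by rewrite exprS EFinM; congr (_ * _)%E.
Qed.

Lemma measurable_ball n : measurable [set x : 'rV[R]_n | enorm x <= 1].
Proof.
have -> : [set x : 'rV[R]_n | enorm x <= 1] = @enorm R n @^-1` `]-oo, 1].
  by apply/seteqP; split=> x /=; rewrite in_itv.
by rewrite -[X in measurable X]setTI; exact: measurable_enorm.
Qed.

(** Finite and positive because the ball lies between the boxes of half-sides
    [1 / n] and [1]. *)
Lemma lebesgue_rV_ball n : (0 < n)%N ->
  0 < ball_volume R n /\
  lebesgue_rV R n [set x | enorm x <= 1] = (ball_volume R n)%:E.
Proof.
move=> n0.
have le1 : (lebesgue_rV R n [set x | (enorm x <= 1)%R] <= ((1 *+ 2) ^+ n)%:E)%E.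
  rewrite -lebesgue_rV_box//; apply: le_measure; rewrite ?inE.
  - exact: measurable_ball.
  - exact: measurable_box.
  - move=> x /= x1 i; apply: le_trans x1.
    by rewrite -sqrtr_sqr ler_sqrt ?dot_ge0//; exact: sqr_coord_le.
have nr : 0 < (n%:R^-1 : R) by rewrite invr_gt0 ltr0n.
have ge : (((n%:R^-1 *+ 2) ^+ n)%:E <=
    lebesgue_rV R n [set x | (enorm x <= 1)%R])%E.
  rewrite -lebesgue_rV_box//; apply: le_measure; rewrite ?inE.
  - exact: measurable_box.
  - exact: measurable_ball.
  - move=> x /= xr; rewrite /enorm -[leRHS]sqrtr1 ler_sqrt// /dot.
    apply: (@le_trans _ _ (\sum_(i < n) n%:R^-1)); last first.
      rewrite sumr_const card_ord -[X in X <= _]mulr_natl.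
      by rewrite mulfV// pnatr_eq0 -lt0n.
    apply: ler_sum => i _; rewrite -expr2 -real_normK ?num_real//.
    apply: (@le_trans _ _ (n%:R^-1 ^+ 2)).
      by rewrite ler_sqr ?nnegrE ?(ltW nr)// xr.
    by rewrite expr2 ger_pMl// invf_le1 ?ltr0n// ler1n.
have fin : lebesgue_rV R n [set x | enorm x <= 1] \is a fin_num.
  by rewrite ge0_fin_numE//; apply: le_lt_trans le1 _; rewrite ltry.
split; last by rewrite /ball_volume fineK.
rewrite -lte_fin /ball_volume fineK//; apply: lt_le_trans ge.
by rewrite lte_fin exprn_gt0// pmulrn_lgt0.
Qed.

End lebesgue_rV_facts.

(** * Spherical Lebesgue measure *)

Section sphere_measure.
Context (R : realType) (n : nat).

(** The space of row vectors with the completed sigma-algebra on which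
    [sphere_measure] is a measure. The name separates it from the same space
    with its Borel sets, since both occur in one statement. *)
Definition lebesgue_sphere_type : Type :=
  caratheodory_type (mu_ext (@borel_sphere_measure R n)).
HB.instance Definition _ := Measurable.on lebesgue_sphere_type.
Notation X := lebesgue_sphere_type.
Notation sigma := (@sphere_measure R n).


Lemma measurable_sphere_type (A : set 'rV[R]_n) : measurable A ->
  measurable (A : set X).
Proof. by move=> mA; apply: sub_caratheodory; exact: sub_sigma_algebra. Qed.

Lemma sphere_measureE (A : set 'rV[R]_n) : measurable A ->
  sigma A = (n%:R%:E *
    lebesgue_rV R n (@normalize R n @^-1` A `&` @punctured_ball R n))%E.
Proof.
move=> mA; by rewrite [LHS](measurable_mu_extE (@borel_sphere_measure R n) mA).
Qed.

Lemma sphere_measure_complete (A B : set X) :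
  sigma B = 0%E -> measurable B -> A `<=` B -> measurable A.
Proof.
by move=> B0 mB AB; apply: measure_is_complete_caratheodory; exists B; split.
Qed.

Lemma measurable_sphere : measurable (@sphere R n).
Proof.
apply: measurable_closed_rV.
by apply: (compact_closed (@norm_hausdorff _ _)); exact: compact_sphere.
Qed.

Lemma punctured_sphere :
  @normalize R n @^-1` sphere `&` @punctured_ball R n = @punctured_ball R n.
Proof.
apply/seteqP; split=> x /=; first by case.
move=> xp; split => //; apply: sphere_normalize.
apply/eqP => x0; move: xp; rewrite x0 /punctured_ball/= => /andP[].
by rewrite enorm0 ltxx.
Qed.

Lemma sphere_measure_sphere : (0 < n)%N ->
  sigma sphere = (n%:R * ball_volume R n)%:E.
Proof.
move=> n0; rewrite sphere_measureE; last exact: measurable_sphere.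
rewrite punctured_sphere EFinM; congr (_ * _)%E.
rewrite -(lebesgue_rV_ball R n0).2.
have -> : [set x : 'rV[R]_n | enorm x <= 1] = @punctured_ball R n `|` [set 0].
  apply/seteqP; split=> x /=; rewrite /punctured_ball/=.
    move=> ->; rewrite andbT; have [->|x0] := eqVneq x 0; first by right.
    left; rewrite lt_neqAle sqrtr_ge0 andbT eq_sym.
    by apply: contra x0 => /eqP/enorm_eq0 ->.
  by case=> [/andP[]//|->]; rewrite enorm0.
have m0 : measurable [set 0 : 'rV[R]_n].
  apply: measurable_closed_rV.
  by apply: (compact_closed (@norm_hausdorff _ _)); exact: compact_set1.
have z : lebesgue_rV R n [set 0] = 0%E.
  apply: (@lebesgue_rV_lines0 _ _ _ (Ordinal n0)) => // x s -> /=.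
  rewrite add0r => /rowP/(_ (Ordinal n0)); rewrite !mxE !eqxx mulr1//.
by rewrite measureU0//; exact: measurable_punctured_ball.
Qed.

Lemma measurable_kinks (g : 'rV[R]_n -> R) : continuous g -> measurable (kinks g).
Proof.
move=> cg; apply: countable_bigcupT_measurable => [|t]; first exact: countableP.
by apply: measurable_closed_rV; exact: closed_coord_kink.
Qed.

(** Each [coord_kink] of a homogeneous function is a cone, so its spherical
    measure is at most [n] times its volume, which vanishes because it meets
    every line in direction [i] at most once. *)
Lemma sphere_measure_kinks (g : 'rV[R]_n -> R) : continuous g ->
  (forall b y, 0 < b -> g (b *: y) = b * g y) -> sigma (kinks g) = 0%E.
Proof.
move=> cg gZ.
have mk t := @closed_coord_kink R n g t.1.1 t.1.2 t.2 cg.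
apply: (@measure_negligible _ X).
  by apply: measurable_sphere_type; exact: measurable_kinks.
pose F k := if unpickle k is Some t then coord_kink g t.1.1 t.1.2 t.2 else set0.
apply: (@negligibleS _ X _ sigma (\bigcup_k F k)).
  by move=> x [t _ tx]; exists (pickle t) => //; rewrite /F pickleK.
apply: (@negligible_bigcup _ X) => k; rewrite /F.
case: unpickle => [t|]; last exact: negligible_set0.
have mt := measurable_closed_rV (mk t).
exists (coord_kink g t.1.1 t.1.2 t.2); split => //.
  exact: measurable_sphere_type.
rewrite [LHS]sphere_measureE//.
rewrite (_ : lebesgue_rV R n _ = 0%E) ?mule0//.
have A0 : lebesgue_rV R n (coord_kink g t.1.1 t.1.2 t.2) = 0%E.
  by apply: (@lebesgue_rV_lines0 _ _ _ t.1.1) => // x s; exact: coord_kink_line.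
apply/eqP; rewrite eq_le measure_ge0 andbT -A0.
apply: le_measure; rewrite ?inE//.
  apply: measurableI; last exact: measurable_punctured_ball.
  by rewrite -[Y in measurable Y]setTI; exact: measurable_normalize.
move=> x [/= kx /andP[x0 _]].
have -> : x = enorm x *: normalize x by rewrite scalerA mulfV ?scale1r// gt_eqF.
exact: coord_kinkZ.
Qed.

End sphere_measure.

(** * Integration against a weighted push-forward *)

Section set_function_integral.
Local Open Scope ereal_scope.
Context d (T : measurableType d) (R : realType).
Import HBNNSimple.

(** The integral is defined for any set function but only evaluates it on
    preimages of points under measurable simple functions. Hence a set function
    that is not a measure, such as [dual_curvature], integrates like any measure
    with the same values on measurable sets. *)
Lemma eq_set_function_integral (m1 m2 : set T -> \bar R) (D : set T)
    (f : T -> \bar R) :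
  (forall A, measurable A -> m1 A = m2 A) ->
  \int[m1]_(x in D) f x = \int[m2]_(x in D) f x.
Proof.
move=> m12; rewrite /integral.
have E (k : {nnsfun T >-> R}) : sintegral m1 k = sintegral m2 k.
  by rewrite /sintegral; apply: eq_fsbigr => r _; rewrite m12.
congr (ereal_sup _ - ereal_sup _); apply: eq_imagel => k _; exact: E.
Qed.

End set_function_integral.

Section weighted_pushforward.
Local Open Scope ereal_scope.
Context d1 d2 (X : measurableType d1) (Y : measurableType d2) (R : realType).
Context (mu : {measure set X -> \bar R}) (D : set X) (w : X -> R) (a : X -> Y).
Hypothesis mD : measurable D.
Hypothesis mw : measurable_fun D w.
Hypothesis w0 : forall x, D x -> (0 <= w x)%R.
Hypothesis ma : measurable_fun D a.

Lemma weighted_pushforward_measure : exists nu : {measure set Y -> \bar R},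
  forall B, nu B = \int[mu]_(x in D `&` a @^-1` B) (w x)%:E.
Proof.
pose nu B := \int[mu]_(x in D `&` a @^-1` B) (w x)%:E.
have nu0 : nu set0 = 0 by rewrite /nu preimage_set0 setI0 integral_set0.
have nu_ge0 B : 0 <= nu B.
  by apply: integral_ge0 => x [Dx _]; rewrite lee_fin w0.
have nu_sigma : semi_sigma_additive nu.
  move=> F mF tF mUF.
  have -> : nu (\bigcup_k F k) = \sum_(i <oo) nu (F i).
    rewrite /nu preimage_bigcup setI_bigcupr.
    apply: ge0_integral_bigcup.
    - by move=> k; exact: ma.
    - apply: (@measurable_funS _ _ _ _ D) => //; first by move=> x [k _ []].
      exact/measurable_EFinP.
    - by move=> x [k _ [Dx _]]; rewrite lee_fin w0.
    - move=> i j _ _ [x [[_ xi] [_ xj]]]; apply: (tF i j) => //.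
      by exists (a x).
  by apply: is_cvg_nneseries => k _ _; exact: nu_ge0.
by exists (HB.pack_for {measure set Y -> \bar R} nu
  (isMeasure.Build _ _ _ nu nu0 nu_ge0 nu_sigma)).
Qed.

Context (nu : {measure set Y -> \bar R}).
Hypothesis nuE : forall B, nu B = \int[mu]_(x in D `&` a @^-1` B) (w x)%:E.

Import HBNNSimple.

Let weighted_nnsfun (k : {nnsfun Y >-> R}) :
  \int[nu]_y (k y)%:E = \int[mu]_(x in D) (k (a x) * w x)%:E.
Proof.
pose ind (r : R) (x : X) : R := (\1_(k @^-1` [set r]) (a x) * w x)%R.
have ind0 r x : D x -> (0 <= ind r x)%R.
  by move=> Dx; rewrite /ind mulr_ge0// w0.
have mi r : measurable_fun D (ind r).
  by apply: measurable_funM => //; exact: (@measurable_comp _ _ _ _ _ _ setT).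
rewrite integralT_nnsfun sintegralE.
transitivity (\sum_(r \in range k) \int[mu]_(x in D) (r%:E * (ind r x)%:E)).
  apply: eq_fsbigr => r /[!inE] -[y _ ry].
  rewrite ge0_integralZl//.
  - congr (_ * _); rewrite nuE integral_mkcondr.
    apply: eq_integral => x _; rewrite /patch /ind indicE.
    rewrite -[x \in _]/(a x \in k @^-1` [set r]).
    by case: ifP => _; rewrite ?mul1r ?mul0r.
  - exact/measurable_EFinP.
  - by move=> x Dx; rewrite lee_fin ind0.
  - by rewrite lee_fin -ry.
rewrite -ge0_integral_fsum//.
- apply: eq_integral => x /[!inE] Dx.
  rewrite [in RHS](fimfunE k) mulr_fsuml -fsumEFin//.
  by apply: eq_fsbigr => r _; rewrite -EFinM mulrA.
- by move=> r; apply: emeasurable_funM => //; exact/measurable_EFinP.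
- move=> r x Dx; rewrite -EFinM lee_fin /ind mulrA mulr_ge0 ?w0//.
  by rewrite -lee_fin; exact: nnfun_muleindic_ge0.
Qed.

(** By linearity for simple functions, then by monotone convergence. *)
Lemma ge0_integral_weighted_pushforward (f : Y -> \bar R) :
  measurable_fun setT f -> (forall y, 0 <= f y) ->
  \int[nu]_y f y = \int[mu]_(x in D) (f (a x) * (w x)%:E).
Proof.
move=> mf f0; pose f_ := nnsfun_approx measurableT mf.
transitivity (limn (fun n => \int[nu]_y (f_ n y)%:E)).
  rewrite -monotone_convergence//=.
  - apply: eq_integral => y _; apply/esym/cvg_lim => //=.
    by apply: cvg_nnsfun_approx.
  - by move=> n; exact/measurable_EFinP.
  - by move=> n x _; rewrite lee_fin.
  - by move=> x _ m n mn; rewrite lee_fin//; exact/lefP/nd_nnsfun_approx.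
under eq_fun do rewrite weighted_nnsfun.
rewrite -monotone_convergence//=.
- apply: eq_integral => x /[!inE] Dx; apply/cvg_lim => //=.
  under eq_fun do rewrite EFinM.
  by apply: cvgeZr => //; exact: cvg_nnsfun_approx.
- move=> n; apply/measurable_EFinP; apply: measurable_funM => //.
  by apply: (@measurable_comp _ _ _ _ _ _ setT).
- by move=> n x Dx; rewrite lee_fin mulr_ge0 ?w0.
- move=> x Dx m n mn; rewrite lee_fin ler_wpM2r ?w0//.
  exact/lefP/nd_nnsfun_approx.
Qed.

(** No integrability is assumed: the two sides have the same positive and the
    same negative part. *)
Lemma integral_weighted_pushforward (f : Y -> R) : measurable_fun setT f ->
  \int[nu]_y (f y)%:E = \int[mu]_(x in D) (f (a x) * w x)%:E.
Proof.
move=> mf; rewrite integralE [RHS]integralE.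
rewrite !ge0_integral_weighted_pushforward//; last 2 first.
  exact/measurable_funeneg/measurable_EFinP.
  exact/measurable_funepos/measurable_EFinP.
congr (_ - _); apply: eq_integral => x /[!inE] Dx.
  by rewrite !funeposE -!EFin_max -EFinM maxr_pMl ?w0// mul0r.
by rewrite !funenegE -!EFinN -!EFin_max -EFinM maxr_pMl ?w0// mul0r mulNr.
Qed.

End weighted_pushforward.

(** * Differentiation under the integral sign *)

Section derive_at0.
Context (R : realType).

Lemma is_derive0P (F : R -> R) (l : R) :
  (F t - F 0) / t @[t --> 0^'] --> l <-> is_derive (0 : R) (1 : R) F l.
Proof.
have E : (fun t : R => t^-1 *: (F (t *: 1 + 0) - F 0)) = (fun t => (F t - F 0) / t).
  by apply/funext => t; rewrite addr0 scaler1 [LHS]mulrC.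
split=> [H|[dF <-]].
  have c : cvg (t^-1 *: ((F \o shift 0) (t *: 1) - F 0) @[t --> 0^']).
    apply/cvg_ex; exists l => /=.
    have := H; rewrite -E => H'; exact: H'.
  apply: DeriveDef => //; rewrite /derive; apply/cvg_lim => //.
  have := H; rewrite -E => H'; exact: H'.
rewrite -E; exact: dF.
Qed.

End derive_at0.

Section derive_under_integral.
Context d (X : measurableType d) (R : realType) (mu : {measure set X -> \bar R}).
Context (D : set X) (L : R -> X -> R) (phi : X -> R) (delta M B C : R).
Context (Phi dPhi : R -> R).
Hypothesis mD : measurable D.
Hypothesis finD : (mu D < +oo)%E.
Hypothesis delta0 : 0 < delta.
Hypothesis mL : forall t, `|t| < delta -> measurable_fun D (L t).
Hypothesis mphi : measurable_fun D phi.
Hypothesis L_phi : forall x, D x -> is_derive (0 : R) (1 : R) (L^~ x) (phi x).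
Hypothesis L_lip : forall t x, `|t| < delta -> D x -> `|L t x - L 0 x| <= M * `|t|.
Hypothesis L0_bound : forall x, D x -> `|L 0 x| <= B.
Hypothesis M0 : 0 <= M.
Hypothesis C0 : 0 <= C.
Hypothesis mPhi : measurable_fun setT Phi.
Hypothesis mdPhi : measurable_fun setT dPhi.
Hypothesis Phi_dPhi : forall y, is_derive (y : R) (1 : R) Phi (dPhi y).
Hypothesis Phi_lip : forall y z, `|y| <= B + M * delta -> `|z| <= B + M * delta ->
  `|Phi y - Phi z| <= C * `|y - z|.

Let L_bound t x : `|t| < delta -> D x -> `|L t x| <= B + M * delta.
Proof.
move=> td Dx; rewrite -[L t x](subrK (L 0 x)) addrC.
apply: (le_trans (ler_normD _ _)); apply: lerD; first exact: L0_bound.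
by apply: le_trans (L_lip td Dx) _; rewrite ler_wpM2l// ltW.
Qed.

Let mPhiL t : `|t| < delta -> measurable_fun D (Phi \o L t).
Proof. by move=> td; apply: measurableT_comp => //; exact: mL. Qed.

Let norm0_lt : `|0 : R| < delta. Proof. by rewrite normr0. Qed.

Lemma integrable_comp t : `|t| < delta -> mu.-integrable D (EFin \o (Phi \o L t)).
Proof.
move=> td; apply: measurable_bounded_integrable => //; first exact: mPhiL.
exists (`|Phi (B + M * delta)| + C * ((B + M * delta) *+ 2)).
split => [|K KB x Dx]; first exact: num_real.
apply: (le_trans _ (ltW KB)) => /=.
have b := L_bound td Dx.
have b0 : 0 <= B + M * delta by exact: le_trans b.
rewrite -[Phi (L t x)](subrK (Phi (B + M * delta))) addrC.
apply: (le_trans (ler_normD _ _)); rewrite lerD2l.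
apply: (le_trans (Phi_lip b _)); first by rewrite ger0_norm.
rewrite ler_wpM2l//; apply: (le_trans (ler_normB _ _)).
by rewrite mulr2n lerD// ger0_norm.
Qed.

(** Dominated convergence along sequences [u n] tending to 0: the difference
    quotients of [Phi \o L] are bounded by [C * M] on a set of finite measure. *)
Theorem derive_under_integral :
  (\int[mu]_(x in D) Phi (L t x) - \int[mu]_(x in D) Phi (L 0 x)) / t
    @[t --> 0^'] --> \int[mu]_(x in D) (dPhi (L 0 x) * phi x).
Proof.
apply/cvgr_dnbhsP => u [u0 ucv].
(* The quotient is set to 0 outside the range of the parameter where the
   hypotheses hold, so that it can be dominated for every [n]. *)
pose F n x := if `|u n| < delta then (Phi (L (u n) x) - Phi (L 0 x)) / u n else 0.
have uD : \forall n \near \oo, `|u n| < delta.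
  by move/cvgr0_norm_lt : ucv; exact.
have mF n : measurable_fun D (F n).
  have [ud|ud] := boolP (`|u n| < delta); rewrite /F ?(negbTE ud); last first.
    exact: measurable_cst.
  rewrite ud.
  apply: measurable_funM; last exact: measurable_cst.
  by apply: measurable_funB; exact: mPhiL.
have Fcv x : D x -> F n x @[n --> \oo] --> dPhi (L 0 x) * phi x.
  move=> Dx.
  have dL := L_phi Dx.
  have : is_derive (0 : R) (1 : R) (Phi \o L^~ x) (dPhi (L 0 x) * phi x).
    exact: is_derive1_comp.
  move/is_derive0P/cvgr_dnbhsP/(_ u (conj u0 ucv)) => H.
  apply: cvg_trans H; apply: near_eq_cvg.
  by apply: filterS uD => n ud; rewrite /F ud.
have Fb n x : D x -> `|F n x| <= C * M.
  move=> Dx; rewrite /F; case: ifPn => [ud|_]; last by rewrite normr0 mulr_ge0.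
  rewrite normrM normfV ler_pdivrMr ?normr_gt0 ?u0//.
  apply: (le_trans (Phi_lip _ _)); try exact: L_bound.
  by rewrite -mulrA ler_wpM2l// L_lip.
have iC : mu.-integrable D (EFin \o cst (C * M)).
  apply: measurable_bounded_integrable => //.
  by exists `|C * M|; split => // K /ltW KB x Dx /=.
have mF' n : measurable_fun D (EFin \o F n) by exact/measurable_EFinP.
have mG : measurable_fun D (EFin \o (fun x => dPhi (L 0 x) * phi x)).
  apply/measurable_EFinP; apply: measurable_funM => //.
  by apply: measurableT_comp => //; exact: mL.
have cvF : {ae mu, forall x, D x ->
    (EFin \o F n) x @[n --> \oo] --> (EFin \o (fun x => dPhi (L 0 x) * phi x)) x}.
  by apply: aeW => x Dx; apply: cvg_EFin; [exact: nearW|exact: Fcv].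
have bF : {ae mu, forall x n, D x ->
    (`|(EFin \o F n) x| <= (C * M)%R%:E)%E}.
  by apply: aeW => x n Dx; rewrite /= lee_fin Fb.
have [iG _] := dominated_convergence mD mF' mG cvF iC bF.
rewrite -[X in _ --> X -> _](fineK (integrable_fin_num mD iG)) => /fine_cvg H.
apply: cvg_trans H; apply: near_eq_cvg.
apply: filterS uD => n ud /=.
rewrite -RintegralB//; [|exact: integrable_comp..].
rewrite -RintegralZr//.
  by congr fine; apply: eq_integral => x _ /=; rewrite /F ud.
have := integrableB mD (integrable_comp ud) (integrable_comp norm0_lt).
by apply: eq_integrable.
Qed.

End derive_under_integral.

(** * First variation of the logarithm of the radial function *)

Section log_gauge.
Context (R : realType) (n : nat) (Omega : set 'rV[R]_n).
Hypothesis Omega0 : Omega !=set0.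
Hypothesis cOmega : compact Omega.
Hypothesis sOmega : Omega `<=` sphere.
Hypothesis hemi : forall u, sphere u -> ~ (Omega `<=` closed_hemisphere u).

Lemma eq_gauge (h k : 'rV[R]_n -> R) :
  (forall v, Omega v -> h v = k v) -> gauge Omega h = gauge Omega k.
Proof.
move=> hk; apply/funext => x; congr sup; apply: eq_imagel => v Ov.
by rewrite hk.
Qed.

Lemma eq_wulff_shape (h k : 'rV[R]_n -> R) :
  (forall v, Omega v -> h v = k v) -> wulff_shape Omega h = wulff_shape Omega k.
Proof.
by move=> hk; apply/seteqP; split => x Kx v Ov; have := Kx v Ov; rewrite hk.
Qed.

(** The logarithm of the radial function, since the latter is the inverse of
    the gauge. In logarithmic form the family [h t] acts additively. *)
Definition log_radial (h : 'rV[R]_n -> R) (u : 'rV[R]_n) : R :=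
  - ln (gauge Omega h u).

(** The vector [v] attains the maximum that defines the gauge, which makes it
    an outer normal at the radial point of [u]. *)
Definition is_normal (h : 'rV[R]_n -> R) (u v : 'rV[R]_n) :=
  Omega v /\ gauge Omega h u = dot u v / h v.

Lemma is_normal_ex (h : 'rV[R]_n -> R) : {within Omega, continuous h} ->
  (forall v, Omega v -> 0 < h v) -> forall u, exists v, is_normal h u v.
Proof.
move=> ch h0 u; have [v Ov [gu _]] := gauge_attained Omega0 cOmega ch h0 u.
by exists v.
Qed.

Lemma is_normal_dot_gt0 (h : 'rV[R]_n -> R) u v : {within Omega, continuous h} ->
  (forall v, Omega v -> 0 < h v) -> u != 0 -> is_normal h u v -> 0 < dot u v.
Proof.
move=> ch h0 u0 [Ov guv].
have := gauge_gt0 Omega0 cOmega sOmega ch h0 hemi u0.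
by rewrite guv pmulr_lgt0// invr_gt0 h0.
Qed.

(** Testing the maximum that defines the gauge of [k] with the normal [v] that
    is optimal for [h]. Applied in both directions, this brackets the increment
    of [log_radial] between the values of the increment of [ln \o h] at two
    normals. *)
Lemma log_radial_le (h k : 'rV[R]_n -> R) u v (e : R) :
  {within Omega, continuous h} -> {within Omega, continuous k} ->
  (forall v, Omega v -> 0 < h v) -> (forall v, Omega v -> 0 < k v) ->
  u != 0 -> is_normal h u v -> ln (k v) = ln (h v) + e ->
  log_radial k u <= log_radial h u + e.
Proof.
move=> ch ck h0 k0 u0 nuv kh; have uv := is_normal_dot_gt0 ch h0 u0 nuv.
have [Ov guv] := nuv.
rewrite /log_radial -[X in _ + X]opprK -opprD lerN2 guv ln_div ?posrE ?h0//.
rewrite -addrA -opprD -kh -ln_div ?posrE ?k0// ler_ln ?posrE ?divr_gt0 ?k0//.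
  exact: gauge_ge.
exact: gauge_gt0.
Qed.

End log_gauge.

Section danskin.
Context (R : realType) (n : nat) (Omega : set 'rV[R]_n).
Context (h0 f : 'rV[R]_n -> R) (h o : R -> 'rV[R]_n -> R) (delta : R).
Hypothesis Omega0 : Omega !=set0.
Hypothesis cOmega : compact Omega.
Hypothesis sOmega : Omega `<=` sphere.
Hypothesis hemi : forall u, sphere u -> ~ (Omega `<=` closed_hemisphere u).
Hypothesis ch0 : {within Omega, continuous h0}.
Hypothesis h0_gt0 : forall v, Omega v -> 0 < h0 v.
Hypothesis cf : {within Omega, continuous f}.
Hypothesis delta0 : 0 < delta.
Hypothesis h00 : forall v, Omega v -> h 0 v = h0 v.
Hypothesis ch : forall t, `|t| < delta -> {within Omega, continuous h t}.
Hypothesis h_gt0 : forall t v, `|t| < delta -> Omega v -> 0 < h t v.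
Hypothesis ln_h : forall t v, `|t| < delta -> Omega v ->
  ln (h t v) = ln (h0 v) + (t * f v + o t v).
Hypothesis o_small : forall e, 0 < e -> \forall t \near (0 : R)^',
  forall v, Omega v -> `|o t v / t| <= e.

Notation L := (fun t => log_radial Omega (h t)).
Notation L0 := (log_radial Omega h0).

Lemma log_radial_upper t u v : `|t| < delta -> u != 0 ->
  is_normal Omega h0 u v -> L t u <= L0 u + (t * f v + o t v).
Proof.
move=> td u0 nuv; have [Ov _] := nuv.
apply: (log_radial_le Omega0 cOmega sOmega hemi ch0 (ch td) h0_gt0 _ u0 nuv).
  by move=> w; exact: h_gt0.
exact: ln_h.
Qed.

Lemma log_radial_lower t u v : `|t| < delta -> u != 0 ->
  is_normal Omega (h t) u v -> L0 u + (t * f v + o t v) <= L t u.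
Proof.
move=> td u0 nuv; have [Ov _] := nuv; rewrite -lerBrDr.
apply: (log_radial_le Omega0 cOmega sOmega hemi (ch td) ch0 _ h0_gt0 u0 nuv).
  by move=> w; exact: h_gt0.
by rewrite (ln_h td Ov) addrK.
Qed.

Lemma log_radial0 : L 0 = L0.
Proof. by rewrite /log_radial (eq_gauge h00). Qed.

(** The value [t = 0] needs [o 0 v = 0], which follows from [h 0 = h0]. *)
Lemma increment_bound : exists r M : R, [/\ 0 < r, r <= delta, 0 <= M &
  forall t v, `|t| < r -> Omega v -> `|t * f v + o t v| <= M * `|t|].
Proof.
have cnf : {within Omega, continuous (fun v => `|f v|)}.
  by move=> x; apply: cvg_norm; exact: cf.
have [w /set_mem Ow wm] := compact_EVT_max Omega0 cOmega cnf.
have /nbhs_ballP[r /= r0 rP] := o_small ltr01.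
exists (Num.min r delta), (`|f w| + 1); split.
- by rewrite lt_min r0.
- by rewrite ge_min lexx orbT.
- by rewrite addr_ge0.
move=> t v; rewrite lt_min => /andP[tr td] Ov.
have fv : `|f v| <= `|f w| by exact: wm (mem_set Ov).
have [->|t0] := eqVneq t 0.
  have := ln_h (v := v) (t := 0) _ Ov; rewrite normr0 => /(_ delta0).
  rewrite h00// => /(congr1 (fun x => x - ln (h0 v))).
  by rewrite subrr addrAC subrr add0r => <-; rewrite normr0 mulr0.
have : `|o t v / t| <= 1 by apply: (rP t) => //; rewrite /ball/= sub0r normrN.
rewrite normrM normfV ler_pdivrMr ?normr_gt0// mul1r => otv.
apply: le_trans (ler_normD _ _) _; rewrite mulrDl mul1r lerD//.
by rewrite normrM mulrC ler_wpM2r.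
Qed.

Lemma log_radial_lipschitz (r M : R) : r <= delta ->
  (forall t v, `|t| < r -> Omega v -> `|t * f v + o t v| <= M * `|t|) ->
  forall t u, `|t| < r -> u != 0 -> `|L t u - L0 u| <= M * `|t|.
Proof.
move=> rd eM t u tr u0; have td := lt_le_trans tr rd.
have [v nv] := is_normal_ex Omega0 cOmega ch0 h0_gt0 u.
have [w nw] := is_normal_ex Omega0 cOmega (ch td)
  (fun w => @h_gt0 t w td) u.
have := log_radial_upper td u0 nv; have := log_radial_lower td u0 nw.
have := eM _ _ tr nv.1; have := eM _ _ tr nw.1.
rewrite !ler_norml => /andP[A B] /andP[A' B'] H1 H2.
by apply/andP; split; lra.
Qed.

(** Compactness turns uniqueness of the normal at [u] into stability: vectors
    of [Omega] that are almost optimal at [u] have almost the same value of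
    [f]. *)
Lemma near_normal_value u v (e : R) : sphere u -> ~ kinks (gauge Omega h0) u ->
  is_normal Omega h0 u v -> 0 < e ->
  exists2 k : R, 0 < k & forall w, Omega w ->
    gauge Omega h0 u - dot u w / h0 w < k -> `|f w - f v| < e.
Proof.
move=> Su Nu [Ov guv] e0.
(* [s] is continuous and positive on [Omega]: its first term vanishes only at
   [v], where the second one is [2 * e]; the second term vanishes as soon as
   [f w] is at distance at least [e] from [f v]. The minimum of [s] is then
   the required constant. *)
pose gap w := gauge Omega h0 u - dot u w / h0 w.
pose def w := e - `|f w - f v|.
pose s w := gap w + (def w + `|def w|).
have cgap : {within Omega, continuous gap}.
  rewrite continuous_subspace_in => w /set_mem Ow.
  apply: cvgB; first exact: cvg_cst.
  apply: cvgM; first exact: (continuous_subspaceT (@continuous_dot _ _ u)).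
  by apply: cvgV; [rewrite gt_eqF// h0_gt0|exact: ch0].
have cdef : {within Omega, continuous def}.
  move=> w; apply: cvgB; first exact: cvg_cst.
  by apply: cvg_norm; apply: cvgB; [exact: cf|exact: cvg_cst].
have cs : {within Omega, continuous s}.
  move=> w; apply: cvgD; first exact: cgap.
  by apply: cvgD; [exact: cdef|apply: cvg_norm; exact: cdef].
have [w0 /set_mem Ow0 w0m] := compact_EVT_min Omega0 cOmega cs.
have gap0 w : Omega w -> 0 <= gap w.
  by move=> Ow; rewrite subr_ge0 gauge_ge.
have s0 : 0 < s w0.
  have d0 : 0 <= def w0 + `|def w0| by rewrite -lerBlDl sub0r -normrN ler_norm.
  have := gap0 _ Ow0; rewrite le_eqVlt => /orP[/eqP g0|g0]; last first.
    by rewrite /s ltr_pwDl.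
  have wv : w0 = v.
    have nw : gauge Omega h0 u = dot u w0 / h0 w0.
      by apply/eqP; rewrite -subr_eq0 -[X in X == _]/(gap w0) -g0.
    apply: (normal_unique Omega0 cOmega sOmega ch0 h0_gt0 hemi
      (sphere_neq0 Su) Nu Ov guv); first exact: sOmega.
    exact: (support_hyperplane_radial Omega0 cOmega sOmega ch0 h0_gt0 hemi
      (sphere_neq0 Su)).
  rewrite /s -g0 add0r /def wv subrr normr0 subr0 gtr0_norm//.
  by rewrite addr_gt0.
exists (s w0) => // w Ow gw; rewrite ltNge; apply/negP => fw.
have := w0m _ (mem_set Ow); rewrite leNgt => /negP; apply.
have -> : s w = gap w; last exact: gw.
have dw : def w <= 0 by rewrite /def subr_le0.
by rewrite /s (ler0_norm dw) subrr addr0.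
Qed.

(** A normal for [h t] loses at most the factor [expR (- 2 * M * `|t|)] when
    it is used for [h0]. *)
Lemma near_normal_of_perturbed u (k : R) : u != 0 -> 0 < k ->
  \forall t \near (0 : R)^', forall w, is_normal Omega (h t) u w ->
    gauge Omega h0 u - dot u w / h0 w < k.
Proof.
move=> u0 k0; have [r [M [r0 rd M0 eM]]] := increment_bound.
have g0 := gauge_gt0 Omega0 cOmega sOmega ch0 h0_gt0 hemi u0.
set g := gauge Omega h0 u in g0 *.
(* A level below [g] that is positive, so that logarithms compare, and at
   least [g - k]. *)
pose c := Num.max (g - k) (g / 2).
have c0 : 0 < c by rewrite lt_max divr_gt0// orbT.
have cg : c < g by rewrite gt_max; apply/andP; split; lra.
have lc : 0 < ln g - ln c by rewrite subr_gt0 ltr_ln.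
have Mt : \forall t \near (0 : R)^', 2 * M * `|t| < ln g - ln c.
  have q0 : 0 < (ln g - ln c) / (2 * M + 1) by rewrite divr_gt0//; lra.
  apply/nbhs_ballP; exists ((ln g - ln c) / (2 * M + 1)) => //= t.
  rewrite /ball/= sub0r normrN ltr_pdivlMr; last lra.
  move=> H _; apply: le_lt_trans H; rewrite mulrC ler_wpM2l//; lra.
have tr : \forall t \near (0 : R)^', `|t| < r.
  by apply/nbhs_ballP; exists r => //= t; rewrite /ball/= sub0r normrN.
near=> t => w nw.
have Mtt : 2 * M * `|t| < ln g - ln c by near: t.
have trr : `|t| < r by near: t.
have td := lt_le_trans trr rd.
have uw := is_normal_dot_gt0 Omega0 cOmega sOmega hemi (ch td)
  (fun w => @h_gt0 t w td) u0 nw.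
have [Ow gw] := nw.
have hw := h0_gt0 Ow.
rewrite ltrBlDr -ltrBlDl; apply: (@le_lt_trans _ _ c); first by rewrite le_max lexx.
rewrite -ltr_ln ?posrE ?divr_gt0// ln_div ?posrE//.
have := log_radial_lipschitz rd eM trr u0.
rewrite /log_radial gw ln_div ?posrE ?(h_gt0 td)// (ln_h td Ow) -/g.
have := eM _ _ trr Ow; rewrite !ler_norml => /andP[A B] /andP[A' B'].
lra.
Unshelve. all: end_near. Qed.

(** An envelope theorem: the difference quotient lies between
    [f w + o t w / t] and [f v + o t v / t], where [w] is a normal for [h t];
    and [f w] tends to [f v] because the normal at [u] is unique. *)
Theorem log_radial_derive u v : sphere u -> ~ kinks (gauge Omega h0) u ->
  is_normal Omega h0 u v -> is_derive (0 : R) (1 : R) (L^~ u) (f v).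
Proof.
move=> Su Nu nuv; have u0 := sphere_neq0 Su; apply/is_derive0P.
apply/cvgrPdist_le => e e0; rewrite log_radial0.
have e20 : 0 < e / 2 by lra.
have [k k0 kP] := near_normal_value Su Nu nuv e20.
have nk := near_normal_of_perturbed u0 k0.
have no := o_small e20.
have td : \forall t \near (0 : R)^', `|t| < delta.
  by apply/nbhs_ballP; exists delta => //= t; rewrite /ball/= sub0r normrN.
have tn0 : \forall t \near (0 : R)^', t != 0.
  exact: nbhs_dnbhs_neq.
near=> t.
have tdd : `|t| < delta by near: t.
have t0 : t != 0 by near: t.
have [w nw] := is_normal_ex Omega0 cOmega (ch tdd)
  (fun w => @h_gt0 t w tdd) u.
have fw : `|f w - f v| < e / 2.
  by apply: kP; [exact: nw.1|move: w nw; near: t].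
have ot z : Omega z -> `|o t z / t| <= e / 2 by move: z; near: t.
have ow := ot w nw.1; have ov := ot v nuv.1.
have up := log_radial_upper tdd u0 nuv.
have lo := log_radial_lower tdd u0 nw.
have qE z : (t * f z + o t z) / t = f z + o t z / t.
  by rewrite mulrDl mulrAC mulfV// mul1r.
move: fw ow ov; rewrite !ler_norml ltr_norml.
move=> /andP[f1 f2] /andP[a1 a2] /andP[b1 b2].
have [tp|tn] := ltP 0 t.
  have : (t * f w + o t w) / t <= (L t u - L0 u) / t.
    by rewrite ler_pM2r ?invr_gt0//; lra.
  have : (L t u - L0 u) / t <= (t * f v + o t v) / t.
    by rewrite ler_pM2r ?invr_gt0//; lra.
  by rewrite !qE => A B; apply/andP; split; lra.
have {}tn : t < 0 by rewrite lt_neqAle t0.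
have : (L t u - L0 u) / t <= (t * f w + o t w) / t.
  by rewrite ler_nM2r ?invr_lt0//; lra.
have : (t * f v + o t v) / t <= (L t u - L0 u) / t.
  by rewrite ler_nM2r ?invr_lt0//; lra.
by rewrite !qE => A B; apply/andP; split; lra.
Unshelve. all: end_near. Qed.

End danskin.

(** * Dual curvature as a push-forward under the radial Gauss map *)

Section curvature.
Context (R : realType) (n : nat) (Omega : set 'rV[R]_n) (h : 'rV[R]_n -> R).
Hypothesis Omega0 : Omega !=set0.
Hypothesis cOmega : compact Omega.
Hypothesis sOmega : Omega `<=` sphere.
Hypothesis hemi : forall u, sphere u -> ~ (Omega `<=` closed_hemisphere u).
Hypothesis ch : {within Omega, continuous h}.
Hypothesis h_gt0 : forall v, Omega v -> 0 < h v.

Notation X := (lebesgue_sphere_type R n).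
Notation sigma := (@sphere_measure R n).
Notation g := (gauge Omega h).
Notation K := (wulff_shape Omega h).

(** Almost all of the sphere; on it the normal at [u] is unique. *)
Definition smooth_part : set 'rV[R]_n := sphere `\` kinks g.

(** On the smooth part this is the radial Gauss map. *)
Definition normal_at (u : 'rV[R]_n) : 'rV[R]_n := xget 0 (is_normal Omega h u).

Lemma normal_atP u : is_normal Omega h u (normal_at u).
Proof.
by have [v nv] := is_normal_ex Omega0 cOmega ch h_gt0 u; exact: xgetI nv.
Qed.

Let continuous_g : continuous g.
Proof. exact: continuous_gauge. Qed.

Lemma measurable_kinks_gauge : measurable (kinks g).
Proof. by apply: measurable_kinks; exact: continuous_g. Qed.

Lemma measurable_smooth_part : measurable smooth_part.
Proof.
by apply: measurableD; [exact: measurable_sphere|exact: measurable_kinks_gauge].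
Qed.

Lemma normal_at_unique u w :
  smooth_part u -> is_normal Omega h u w -> w = normal_at u.
Proof.
move=> [Su Nu] [Ow guw]; have [Ov guv] := normal_atP u.
apply: (normal_unique Omega0 cOmega sOmega ch h_gt0 hemi
  (sphere_neq0 Su) Nu Ov guv); first exact: sOmega.
exact: (support_hyperplane_radial Omega0 cOmega sOmega ch h_gt0 hemi
  (sphere_neq0 Su)).
Qed.

(** For [U] open, the normal at a smooth [u] lies in [U] exactly when the
    maximum over the compact set [Omega `\` U] is smaller than the gauge, and
    both maxima are continuous in [u]. If that compact set is empty, every
    normal lies in [U]. *)
Lemma measurable_normal_at : measurable_fun smooth_part normal_at.
Proof.
apply: (@measurability _ _ _ _ _ _ (@open 'rV[R]_n)) => //.
move=> _ [U oU <-].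
pose F := Omega `&` ~` U.
have cF : compact F by apply: compact_closedI => //; exact: open_closedC.
have [F0|/set0P F0] := eqVneq F set0.
  rewrite (_ : _ `&` _ = smooth_part); first exact: measurable_smooth_part.
  apply/seteqP; split => [u []//|u Du]; split => //=.
  apply: contrapT => nU; have : F (normal_at u).
    by split => //; exact: (normal_atP u).1.
  by rewrite F0.
have FO : F `<=` Omega by move=> v [].
have cgF : continuous (gauge F h).
  apply: continuous_gauge => //.
  - by move=> v /FO; exact: sOmega.
  - exact: continuous_subspaceW ch.
  - by move=> v /FO; exact: h_gt0.
have mlt : measurable [set u | gauge F h u < g u].
  apply: measurable_open_rV.
  have -> : [set u | gauge F h u < g u] =
      (fun u => g u - gauge F h u) @^-1` [set r | 0 < r].
    by apply/seteqP; split => u /=; rewrite subr_gt0.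
  apply: open_comp; last exact: open_gt.
  by move=> u _; apply: continuousB; [exact: continuous_g|exact: cgF].
rewrite (_ : _ `&` _ = smooth_part `&` [set u | gauge F h u < g u]).
  by apply: measurableI => //; exact: measurable_smooth_part.
have hF v : F v -> 0 < h v by move/FO; exact: h_gt0.
have chF : {within F, continuous h} by exact: continuous_subspaceW ch.
apply/seteqP; split => u [Du]; split => //=.
  rewrite ltNge; apply/negP => gle.
  have [w Fw [gw _]] := gauge_attained F0 cF chF hF u.
  have nw : is_normal Omega h u w.
    split; first exact: FO.
    apply/eqP; rewrite eq_le; apply/andP; split; first by rewrite -gw.
    by apply: gauge_ge => //; exact: FO.
  by have [_ []] := Fw; rewrite (normal_at_unique Du nw).
apply: contrapT => nU.
have [Ov gv] := normal_atP u.
have : dot u (normal_at u) / h (normal_at u) <= gauge F h u.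
  by apply: gauge_ge.
by rewrite -gv leNgt; apply/negP/negPn.
Qed.

Lemma reverse_gauss_smooth B :
  reverse_gauss K B `\` kinks g = smooth_part `&` normal_at @^-1` B.
Proof.
apply/seteqP; split => u.
  move=> [[Su [w [Sw Bw uw]]] Nu]; split => //=.
  have [Ov guv] := normal_atP u.
  by rewrite -(normal_unique Omega0 cOmega sOmega ch h_gt0 hemi
    (sphere_neq0 Su) Nu Ov guv Sw uw).
move=> [[Su Nu] Bu]; split => //; split => //; exists (normal_at u).
have [Ov guv] := normal_atP u; split => //; first exact: sOmega.
exact: (support_hyperplane_radial Omega0 cOmega sOmega ch h_gt0 hemi
  (sphere_neq0 Su)).
Qed.

Lemma sphere_measure_kinks_gauge : sigma (kinks g) = 0%E.
Proof.
apply: sphere_measure_kinks; first exact: continuous_g.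
by move=> b y b0; exact: gaugeZ.
Qed.

Lemma measurable_lebesgue_sphere d (T : measurableType d) (D : set 'rV[R]_n)
    (F : 'rV[R]_n -> T) :
  measurable D -> measurable_fun D F -> measurable_fun (D : set X) (F : X -> T).
Proof. by move=> mD mF _ B mB; apply: measurable_sphere_type; exact: mF. Qed.

Lemma measurable_log_radial (D : set 'rV[R]_n) : measurable D ->
  measurable_fun D (log_radial Omega h).
Proof.
move=> mD; apply: measurableT_comp; first exact: oppr_measurable.
apply: measurableT_comp; first exact: measurable_ln.
by apply: continuous_measurable_rV => //; exact: continuous_g.
Qed.

Lemma ln_radial_fun u : sphere u -> ln (radial_fun K u) = log_radial Omega h u.
Proof.
move=> /sphere_neq0 u0.
rewrite (radial_fun_wulff Omega0 cOmega sOmega ch h_gt0 hemi u0) lnV//.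
by rewrite posrE; exact: (gauge_gt0 Omega0 cOmega sOmega ch h_gt0 hemi).
Qed.

Lemma radial_fun_powR q u : sphere u ->
  radial_fun K u `^ q = expR (q * log_radial Omega h u).
Proof.
move=> Su; rewrite -ln_radial_fun// /powR gt_eqF//.
rewrite (radial_fun_wulff Omega0 cOmega sOmega ch h_gt0 hemi (sphere_neq0 Su)).
rewrite invr_gt0.
exact: (gauge_gt0 Omega0 cOmega sOmega ch h_gt0 hemi (sphere_neq0 Su)).
Qed.

Lemma Rintegral_smooth_part (F : 'rV[R]_n -> R) :
  measurable_fun (sphere : set X) (F : X -> R) ->
  \int[sigma]_(u in sphere) F u = \int[sigma]_(u in smooth_part) F u.
Proof.
move=> mF; congr fine; rewrite integralE [RHS]integralE.
have mN : measurable (kinks g : set X).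
  by apply: measurable_sphere_type; exact: measurable_kinks_gauge.
have mS : measurable (sphere : set X).
  by apply: measurable_sphere_type; exact: measurable_sphere.
congr (_ - _)%E.
- apply: (@ge0_negligible_integral _ X _ sigma sphere (kinks g)) => //.
    exact/measurable_funepos/measurable_EFinP.
  exact: sphere_measure_kinks_gauge.
- apply: (@ge0_negligible_integral _ X _ sigma sphere (kinks g)) => //.
    exact/measurable_funeneg/measurable_EFinP.
  exact: sphere_measure_kinks_gauge.
Qed.

Definition curvature_density (q : R) (u : 'rV[R]_n) : R :=
  n%:R^-1 * expR (q * log_radial Omega h u).

Lemma measurable_exp_log_radial q (D : set 'rV[R]_n) : measurable D ->
  measurable_fun D (fun u => expR (q * log_radial Omega h u)).
Proof.
move=> mD; apply: measurableT_comp; first exact: measurable_expR.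
by apply: measurable_funM; [exact: measurable_cst|exact: measurable_log_radial].
Qed.

(** The set [reverse_gauss K B] differs from the preimage of [B] by a subset
    of the kinks, which need not be Borel: its measurability comes from the
    completeness of the spherical measure. *)
Lemma dual_curvatureE q B : measurable B ->
  dual_curvature q K B =
  (\int[sigma]_(u in smooth_part `&` normal_at @^-1` B)
     (curvature_density q u)%:E)%E.
Proof.
move=> mB.
have mN : measurable (kinks g : set X).
  by apply: measurable_sphere_type; exact: measurable_kinks_gauge.
have mDB : measurable (smooth_part `&` normal_at @^-1` B : set X).
  apply: measurable_sphere_type; apply: measurable_normal_at => //.
  exact: measurable_smooth_part.
have mrg : measurable (reverse_gauss K B : set X).
  rewrite -(setUIDK (reverse_gauss K B) (kinks g)); apply: measurableU.
    apply: (sphere_measure_complete sphere_measure_kinks_gauge mN).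
    exact: subIsetr.
  by rewrite reverse_gauss_smooth.
have rS : reverse_gauss K B `<=` sphere by move=> u [].
rewrite /dual_curvature.
transitivity ((n%:R^-1)%:E * \int[sigma]_(u in reverse_gauss K B)
    (expR (q * log_radial Omega h u))%:E)%E.
  congr (_ * _)%E; apply: eq_integral => u /[!inE] /rS Su.
  by rewrite radial_fun_powR.
have mE (D : set X) : measurable D ->
    measurable_fun D (fun u : X => (expR (q * log_radial Omega h u))%:E).
  have mF := measurable_lebesgue_sphere measurableT
    (measurable_exp_log_radial q measurableT).
  move=> mD; apply/measurable_EFinP.
  exact: (@measurable_funS _ _ X _ setT D _ measurableT (@subsetT _ D) mF).
have E0 (D : set X) (u : X) : D u ->
    (0 <= (expR (q * log_radial Omega h u))%:E)%E.
  by move=> _; rewrite lee_fin expR_ge0.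
rewrite (ge0_negligible_integral mN mrg (mE _ mrg) (E0 _)
  sphere_measure_kinks_gauge).
rewrite reverse_gauss_smooth; symmetry.
have ninv : 0 <= (n%:R^-1 : R) by rewrite invr_ge0.
exact: (ge0_integralZl_EFin sigma mDB (E0 _) (mE _ mDB) ninv).
Qed.

(** The transfer formula: integrating against the dual curvature measure is
    integrating along the radial Gauss map. *)
Lemma dual_curvature_integralE q (f : 'rV[R]_n -> R) :
  {within Omega, continuous f} ->
  dual_curvature_integral q K Omega f =
  \int[sigma]_(u in smooth_part) (f (normal_at u) * curvature_density q u).
Proof.
move=> cf; congr fine.
have mD : measurable (smooth_part : set X).
  by apply: measurable_sphere_type; exact: measurable_smooth_part.
have mOm : measurable Omega.
  by apply: measurable_closed_rV; apply: (compact_closed (@norm_hausdorff _ _)).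
have mw : measurable_fun (smooth_part : set X) (curvature_density q : X -> R).
  apply: measurable_lebesgue_sphere; first exact: measurable_smooth_part.
  apply: measurable_funM; first exact: measurable_cst.
  by apply: measurable_exp_log_radial; exact: measurable_smooth_part.
have w0 (u : X) : smooth_part u -> 0 <= curvature_density q u.
  by move=> _; rewrite mulr_ge0 ?invr_ge0 ?expR_ge0.
have mnorm : measurable_fun (smooth_part : set X) (normal_at : X -> 'rV[R]_n).
  apply: measurable_lebesgue_sphere; first exact: measurable_smooth_part.
  exact: measurable_normal_at.
have [nu nuE] := weighted_pushforward_measure sigma mD mw w0 mnorm.
rewrite (@eq_set_function_integral _ _ _ _ nu); last first.
  by move=> B mB; rewrite dual_curvatureE// -nuE.
rewrite integral_mkcond restrict_EFin.
rewrite (integral_weighted_pushforward mD mw w0 mnorm nuE); last first.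
  apply/(measurable_restrictT _ mOm); exact: within_continuous_measurable_rV.
by apply: eq_integral => u _; rewrite patchT// inE; exact: (normal_atP u).1.
Qed.

End curvature.

(** * Variational formulas for dual volumes *)

Lemma is_derive_scaled_ln (R : realType) (F : R -> R) (l a b : R) :
  0 < a -> 0 < F 0 -> is_derive (0 : R) (1 : R) F l ->
  is_derive (0 : R) (1 : R) (fun t => b * ln (a * F t)) (b * (l / F 0)).
Proof.
move=> a0 F0 dF.
have daF : is_derive (0 : R) (1 : R) (fun t => a * F t) (a * l).
  exact: is_deriveZ.
have aF0 : 0 < a * F 0 by rewrite mulr_gt0.
have dl : is_derive (a * F 0) (1 : R) (@ln R) (a * F 0)^-1 by exact: is_derive1_ln.
have -> : b * (l / F 0) = b * ((a * F 0)^-1 * (a * l)).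
  by congr (_ * _); field; rewrite !gt_eqF.
by apply: is_deriveZ; exact: (@is_derive1_comp _ (@ln R) (fun t => a * F t)).
Qed.

Section variational_formula.
Context (R : realType) (n : nat) (Omega : set 'rV[R]_n).
Context (h0 f : 'rV[R]_n -> R) (h o : R -> 'rV[R]_n -> R) (delta : R).
Hypothesis n_gt0 : (0 < n)%N.
Hypothesis Omega0 : Omega !=set0.
Hypothesis cOmega : compact Omega.
Hypothesis sOmega : Omega `<=` sphere.
Hypothesis hemi : forall u, sphere u -> ~ (Omega `<=` closed_hemisphere u).
Hypothesis ch0 : {within Omega, continuous h0}.
Hypothesis h0_gt0 : forall v, Omega v -> 0 < h0 v.
Hypothesis cf : {within Omega, continuous f}.
Hypothesis delta0 : 0 < delta.
Hypothesis h00 : forall v, Omega v -> h 0 v = h0 v.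
Hypothesis ch : forall t, `|t| < delta -> {within Omega, continuous h t}.
Hypothesis h_gt0 : forall t v, `|t| < delta -> Omega v -> 0 < h t v.
Hypothesis ln_h : forall t v, `|t| < delta -> Omega v ->
  ln (h t v) = ln (h0 v) + (t * f v + o t v).
Hypothesis o_small : forall e : R, 0 < e -> \forall t \near (0 : R)^',
  forall v, Omega v -> `|o t v / t| <= e.

Notation X := (lebesgue_sphere_type R n).
Notation sigma := (@sphere_measure R n).
Notation L := (fun t => log_radial Omega (h t)).
Notation L0 := (log_radial Omega h0).
Notation D := (smooth_part Omega h0).
Notation alpha := (normal_at Omega h0).

Let mD : measurable (D : set X).
Proof. by apply: measurable_sphere_type; exact: measurable_smooth_part. Qed.

Lemma log_radial_bounded :
  exists2 B : R, 0 <= B & forall u, sphere u -> `|L0 u| <= B.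
Proof.
have [v Ov] := Omega0.
have S0 : @sphere R n !=set0 by exists v; exact: sOmega.
have cg : {within sphere, continuous (gauge Omega h0)}.
  by apply: continuous_subspaceT; exact: continuous_gauge.
have [a /set_mem Sa am] := compact_EVT_min S0 (@compact_sphere R n) cg.
have [b /set_mem Sb bm] := compact_EVT_max S0 (@compact_sphere R n) cg.
have gp u : sphere u -> 0 < gauge Omega h0 u.
  by move=> /sphere_neq0; exact: gauge_gt0.
exists (`|L0 a| + `|L0 b|); first by rewrite addr_ge0.
move=> u Su.
have H1 : ln (gauge Omega h0 a) <= ln (gauge Omega h0 u).
  by rewrite ler_ln ?posrE ?gp//; exact: am (mem_set Su).
have H2 : ln (gauge Omega h0 u) <= ln (gauge Omega h0 b).
  by rewrite ler_ln ?posrE ?gp//; exact: bm (mem_set Su).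
have := ler_norm (- ln (gauge Omega h0 a)).
have := ler_norm (ln (gauge Omega h0 b)).
have := normr_ge0 (ln (gauge Omega h0 a)).
have := normr_ge0 (ln (gauge Omega h0 b)).
rewrite /log_radial !normrN => A1 A2 A3 A4.
by rewrite ler_norml; apply/andP; split; lra.
Qed.

Lemma sphere_measure_smooth_part : sigma D = (n%:R * ball_volume R n)%:E.
Proof.
have mS : measurable (sphere : set X).
  by apply: measurable_sphere_type; exact: measurable_sphere.
have mN : measurable (kinks (gauge Omega h0) : set X).
  by apply: measurable_sphere_type; exact: measurable_kinks_gauge.
have kN := sphere_measure_kinks_gauge Omega0 cOmega sOmega ch0 h0_gt0.
rewrite -sphere_measure_sphere//.
have := @ge0_negligible_integral _ X _ sigma sphere (kinks (gauge Omega h0))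
  (cst 1%E) mN mS (measurable_cst _) (fun _ _ => lee01) kN.
by rewrite !integral_cst// !mul1e => ->.
Qed.

Lemma Rintegral_cst_smooth_part (c : R) :
  \int[sigma]_(u in D) c = c * (n%:R * ball_volume R n).
Proof.
rewrite (Rintegral_cst sigma mD); congr (_ * _).
exact: (congr1 fine sphere_measure_smooth_part).
Qed.

Let finD : (sigma D < +oo)%E.
Proof. by rewrite sphere_measure_smooth_part ltry. Qed.

Let f_bound : exists2 A : R, 0 <= A & forall v, Omega v -> `|f v| <= A.
Proof.
have cnf : {within Omega, continuous (fun v => `|f v|)}.
  by move=> x; apply: cvg_norm; exact: cf.
have [w /set_mem Ow wm] := compact_EVT_max Omega0 cOmega cnf.
by exists `|f w| => // v Ov; exact: wm (mem_set Ov).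
Qed.

Let nuO u : Omega (alpha u).
Proof. exact: (normal_atP Omega0 cOmega ch0 h0_gt0 u).1. Qed.

Let mfnu : measurable_fun (D : set X) (fun u : X => f (alpha u)).
Proof.
have mOm : measurable Omega.
  by apply: measurable_closed_rV; apply: (compact_closed (@norm_hausdorff _ _)).
apply: measurable_lebesgue_sphere; first exact: measurable_smooth_part.
apply: (@measurable_comp _ _ _ _ _ _ Omega) => //.
- by move=> _ [u _ <-]; exact: nuO.
- exact: within_continuous_measurable_rV.
- exact: measurable_normal_at.
Qed.

(** The common core of the formulas: [Phi y = expR (q * y)] gives the dual
    volume of order [q], and the identity gives the logarithmic case. *)
Theorem derive_Rintegral_log_radial (Phi dPhi : R -> R) :
  measurable_fun setT Phi -> measurable_fun setT dPhi ->
  (forall y, is_derive (y : R) (1 : R) Phi (dPhi y)) ->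
  (forall A : R, exists2 C : R, 0 <= C & forall y z, `|y| <= A -> `|z| <= A ->
     `|Phi y - Phi z| <= C * `|y - z|) ->
  (\int[sigma]_(u in D) Phi (L t u) - \int[sigma]_(u in D) Phi (L0 u)) / t
    @[t --> 0^'] --> \int[sigma]_(u in D) (dPhi (L0 u) * f (alpha u)).
Proof.
move=> mPhi mdPhi dP Plip.
have [B B0 LB] := log_radial_bounded.
have [r [M [r0 rd M0 eM]]] :=
  increment_bound Omega0 cOmega cf delta0 h00 ln_h o_small.
have [C C0 CP] := Plip (B + M * r).
have E0 : L 0 = L0 by exact: log_radial0.
rewrite -E0.
apply: (@derive_under_integral _ X R sigma D L (fun u => f (alpha u)) r M B C
  Phi dPhi) => //.
- move=> t tr; have td := lt_le_trans tr rd.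
  apply: measurable_lebesgue_sphere; first exact: measurable_smooth_part.
  apply: measurable_log_radial => //; first exact: ch.
    by move=> v; exact: h_gt0.
  exact: measurable_smooth_part.
- move=> u [Su Nu].
  apply: (log_radial_derive Omega0 cOmega sOmega hemi ch0 h0_gt0 cf delta0 h00
    ch h_gt0 ln_h o_small Su Nu).
  exact: normal_atP.
- move=> t u tr [Su _]; rewrite E0.
  exact: (log_radial_lipschitz Omega0 cOmega sOmega hemi ch0 h0_gt0 ch h_gt0
    ln_h rd eM tr (sphere_neq0 Su)).
- by move=> u [Su _]; rewrite E0 LB.
Qed.

Lemma dual_volumeE q t : `|t| < delta ->
  dual_volume q (wulff_shape Omega (h t)) =
  n%:R^-1 * \int[sigma]_(u in D) expR (q * L t u).
Proof.
move=> td; congr (_ * _).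
have ht v : Omega v -> 0 < h t v by exact: h_gt0.
rewrite -(Rintegral_smooth_part Omega0 cOmega sOmega ch0 h0_gt0
  (F := fun u => expR (q * L t u))).
  apply: eq_Rintegral => u /[!inE] Su.
  exact: (radial_fun_powR Omega0 cOmega sOmega hemi (ch td) ht q Su).
apply: measurable_lebesgue_sphere; first exact: measurable_sphere.
by apply: measurable_exp_log_radial => //; [exact: ch|exact: measurable_sphere].
Qed.

Lemma Rintegral_ln_radial t : `|t| < delta ->
  \int[sigma]_(u in sphere) ln (radial_fun (wulff_shape Omega (h t)) u) =
  \int[sigma]_(u in D) L t u.
Proof.
move=> td.
have ht v : Omega v -> 0 < h t v by exact: h_gt0.
rewrite -(Rintegral_smooth_part Omega0 cOmega sOmega ch0 h0_gt0 (F := L t)).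
  apply: eq_Rintegral => u /[!inE] Su.
  exact: (ln_radial_fun Omega0 cOmega sOmega hemi (ch td) ht Su).
apply: measurable_lebesgue_sphere; first exact: measurable_sphere.
by apply: measurable_log_radial => //; [exact: ch|exact: measurable_sphere].
Qed.

Lemma integrable_normal_density q :
  sigma.-integrable D
    (EFin \o (fun u : X => f (alpha u) * curvature_density Omega h0 q u)).
Proof.
have [B B0 LB] := log_radial_bounded; have [A A0 fA] := f_bound.
have md : measurable_fun (D : set X) (curvature_density Omega h0 q : X -> R).
  apply: measurable_lebesgue_sphere; first exact: measurable_smooth_part.
  apply: measurable_funM; first exact: measurable_cst.
  by apply: measurable_exp_log_radial => //; exact: measurable_smooth_part.
have mF := measurable_funM mfnu md.
apply: (measurable_bounded_integrable mD finD mF).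
exists (A * (n%:R^-1 * expR (`|q| * B))); split => [|k /ltW kA u [Su _]].
  exact: num_real.
apply: le_trans kA; rewrite normrM ler_pM ?fA//.
rewrite /curvature_density normrM ler_pM//; first by rewrite ger0_norm ?invr_ge0.
rewrite ger0_norm ?expR_ge0// ler_expR; apply: le_trans (ler_norm _) _.
by rewrite normrM ler_wpM2l// LB.
Qed.

Let norm0_lt : `|0 : R| < delta. Proof. by rewrite normr0. Qed.

Let K00 : wulff_shape Omega (h 0) = wulff_shape Omega h0.
Proof. exact: eq_wulff_shape. Qed.

Let curvE q : dual_curvature_integral q (wulff_shape Omega h0) Omega f =
  \int[sigma]_(u in D) (f (alpha u) * curvature_density Omega h0 q u).
Proof. exact: dual_curvature_integralE. Qed.

Let near_delta : \forall t \near (0 : R)^', `|t| < delta.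
Proof.
by apply/nbhs_ballP; exists delta => //= t; rewrite /ball/= sub0r normrN.
Qed.

(** From [expR a - expR b = expR a * (1 - expR (b - a))] and
    [1 + x <= expR x]. *)
Lemma expR_lipschitz (q A : R) : exists2 C : R, 0 <= C &
  forall y z : R, `|y| <= A -> `|z| <= A ->
    `|expR (q * y) - expR (q * z)| <= C * `|y - z|.
Proof.
exists (expR (`|q| * A) * `|q|); first by rewrite mulr_ge0 ?expR_ge0.
have H (a b : R) : b <= a -> `|expR a - expR b| <= expR a * `|a - b|.
  move=> ba; rewrite !ger0_norm ?subr_ge0 ?ler_expR//.
  have := expR_ge1Dx (b - a); rewrite expRD expRN => e1.
  rewrite -[leLHS]mulr1 -(@mulfV _ (expR a)) ?gt_eqF ?expR_gt0//.
  rewrite mulrCA ler_pM2l ?expR_gt0//.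
  rewrite mulrBl mulfV ?gt_eqF ?expR_gt0//; lra.
have E y : `|y| <= A -> expR (q * y) <= expR (`|q| * A).
  move=> yA; rewrite ler_expR; apply: le_trans (ler_norm _) _.
  by rewrite normrM ler_wpM2l.
move=> y z yA zA; rewrite -mulrA -normrM mulrBr.
have [yz|/ltW yz] := leP (q * z) (q * y).
  by apply: le_trans (H _ _ yz) _; rewrite ler_wpM2r// E.
rewrite distrC (distrC (q * y)).
by apply: le_trans (H _ _ yz) _; rewrite ler_wpM2r// E.
Qed.

Theorem dual_volume_derive q :
  (dual_volume q (wulff_shape Omega (h t)) -
     dual_volume q (wulff_shape Omega h0)) / t @[t --> 0^'] -->
  q * dual_curvature_integral q (wulff_shape Omega h0) Omega f.
Proof.
have H := @derive_Rintegral_log_radial (fun y => expR (q * y))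
  (fun y => q * expR (q * y)) _ _ _ (expR_lipschitz q).
have {H} : (\int[sigma]_(u in D) expR (q * L t u) -
      \int[sigma]_(u in D) expR (q * L0 u)) / t @[t --> 0^'] -->
    \int[sigma]_(u in D) (q * expR (q * L0 u) * f (alpha u)).
  apply: H.
  - by apply: measurableT_comp; [exact: measurable_expR|exact: measurable_funM].
  - apply: measurable_funM => //.
    by apply: measurableT_comp; [exact: measurable_expR|exact: measurable_funM].
  - move=> y.
    have H : is_derive (y : R) (1 : R) (fun y => q * y) (q * 1).
      by apply: is_deriveZ.
    rewrite mulrC -[X in _ * X]mulr1.
    exact: (is_derive1_comp (is_derive_expR _) H).
move=> H.
have n0 : n%:R != 0 :> R by rewrite pnatr_eq0 -lt0n.
have -> : q * dual_curvature_integral q (wulff_shape Omega h0) Omega f =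
    n%:R^-1 * \int[sigma]_(u in D) (q * expR (q * L0 u) * f (alpha u)).
  rewrite curvE.
  have -> : \int[sigma]_(u in D) (q * expR (q * L0 u) * f (alpha u)) =
      \int[sigma]_(u in D)
        ((n%:R * q) * (f (alpha u) * curvature_density Omega h0 q u)).
    by apply: eq_Rintegral => u _; rewrite /curvature_density; field.
  rewrite (RintegralZl _ mD (integrable_normal_density q)).
  by rewrite !mulrA mulVf// mul1r.
have H' : n%:R^-1 * ((\int[sigma]_(u in D) expR (q * L t u) -
      \int[sigma]_(u in D) expR (q * L0 u)) / t) @[t --> 0^'] -->
    n%:R^-1 * \int[sigma]_(u in D) (q * expR (q * L0 u) * f (alpha u)).
  by apply: cvgM H; exact: cvg_cst.
have V0E := dual_volumeE q norm0_lt; rewrite K00 (log_radial0 h00) in V0E.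
apply: cvg_trans H'; apply: near_eq_cvg; apply: filterS near_delta => t td.
rewrite mulrA mulrBr.
exact/esym/(congr2 (fun a b => (a - b) / t) (dual_volumeE q td) V0E).
Qed.

Lemma dual_volume_gt0 q : 0 < dual_volume q (wulff_shape Omega h0).
Proof.
rewrite -K00 dual_volumeE// (log_radial0 h00).
have [B B0 LB] := log_radial_bounded.
rewrite pmulr_rgt0 ?invr_gt0 ?ltr0n//.
apply: (@lt_le_trans _ _ (\int[sigma]_(u in D) expR (- (`|q| * B)))).
  rewrite Rintegral_cst_smooth_part.
  rewrite mulr_gt0 ?expR_gt0// mulr_gt0 ?ltr0n//.
  exact: (lebesgue_rV_ball R n_gt0).1.
have md : measurable_fun (D : set X) ((fun u => expR (q * L0 u)) : X -> R).
  apply: measurable_lebesgue_sphere; first exact: measurable_smooth_part.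
  by apply: measurable_exp_log_radial => //; exact: measurable_smooth_part.
have qL u : D u -> `|q * L0 u| <= `|q| * B.
  by move=> [Su _]; rewrite normrM ler_wpM2l// LB.
apply: (le_Rintegral mD).
- apply: (measurable_bounded_integrable mD finD (measurable_cst _)).
  exists (expR (- (`|q| * B))); split => [|k /ltW kA u _]; first exact: num_real.
  by apply: le_trans kA; rewrite /= ger0_norm ?expR_ge0.
- apply: (measurable_bounded_integrable mD finD md).
  exists (expR (`|q| * B)); split => [|k /ltW kA u Du]; first exact: num_real.
  apply: le_trans kA; rewrite /= ger0_norm ?expR_ge0// ler_expR.
  exact: le_trans (ler_norm _) (qL u Du).
- move=> u Du; rewrite ler_expR; have := qL u Du.
  by rewrite ler_norml => /andP[].
Qed.

Lemma ln_normalized_dual_volume q (K : set 'rV[R]_n) : q != 0 ->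
  ln (normalized_dual_volume q K) =
  q^-1 * ln ((ball_volume R n)^-1 * dual_volume q K).
Proof.
move=> q0; rewrite /normalized_dual_volume (negbTE q0) ln_powR.
congr (_ * ln _).
by rewrite /dual_volume invfM mulrA [X in X * _]mulrC.
Qed.

Lemma ln_normalized_dual_volume0 (K : set 'rV[R]_n) :
  ln (normalized_dual_volume 0 K) =
  (n%:R * ball_volume R n)^-1 * \int[sigma]_(u in sphere) ln (radial_fun K u).
Proof. by rewrite /normalized_dual_volume eqxx expRK. Qed.

Lemma dual_volume0 : dual_volume 0 (wulff_shape Omega h0) = ball_volume R n.
Proof.
rewrite -K00 dual_volumeE//.
under eq_Rintegral do rewrite mul0r expR0.
rewrite Rintegral_cst_smooth_part mul1r mulKf//.
by rewrite pnatr_eq0 -lt0n.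
Qed.

Theorem ln_dual_volume0_derive :
  (ln (normalized_dual_volume 0 (wulff_shape Omega (h t))) -
     ln (normalized_dual_volume 0 (wulff_shape Omega h0))) / t @[t --> 0^'] -->
  (ball_volume R n)^-1 * dual_curvature_integral 0 (wulff_shape Omega h0) Omega f.
Proof.
have n0 : n%:R != 0 :> R by rewrite pnatr_eq0 -lt0n.
have H : (\int[sigma]_(u in D) L t u - \int[sigma]_(u in D) L0 u) / t
    @[t --> 0^'] --> \int[sigma]_(u in D) (1 * f (alpha u)).
  apply: (@derive_Rintegral_log_radial id (fun=> 1)) => //.
  by move=> A; exists 1 => // y z _ _; rewrite mul1r.
have -> : (ball_volume R n)^-1 *
      dual_curvature_integral 0 (wulff_shape Omega h0) Omega f =
    (n%:R * ball_volume R n)^-1 * \int[sigma]_(u in D) (1 * f (alpha u)).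
  rewrite curvE.
  have -> : \int[sigma]_(u in D) (1 * f (alpha u)) =
      \int[sigma]_(u in D)
        (n%:R * (f (alpha u) * curvature_density Omega h0 0 u)).
    apply: eq_Rintegral => u _.
    by rewrite /curvature_density mul0r expR0; field.
  rewrite (RintegralZl _ mD (integrable_normal_density 0)) invfM.
  by rewrite [X in _ = X * _]mulrC mulrA mulfVK.
have lnE s : `|s| < delta ->
    ln (normalized_dual_volume 0 (wulff_shape Omega (h s))) =
    (n%:R * ball_volume R n)^-1 * \int[sigma]_(u in D) L s u.
  move=> sd; rewrite ln_normalized_dual_volume0; congr (_ * _).
  exact: Rintegral_ln_radial.
have ln0E := lnE 0 norm0_lt; rewrite K00 (log_radial0 h00) in ln0E.
have H' : (n%:R * ball_volume R n)^-1 *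
    ((\int[sigma]_(u in D) L t u - \int[sigma]_(u in D) L0 u) / t) @[t --> 0^'] -->
    (n%:R * ball_volume R n)^-1 * \int[sigma]_(u in D) (1 * f (alpha u)).
  by apply: cvgM H; exact: cvg_cst.
apply: cvg_trans H'; apply: near_eq_cvg; apply: filterS near_delta => t td.
rewrite mulrA mulrBr.
exact/esym/(congr2 (fun a b => (a - b) / t) (lnE t td) ln0E).
Qed.

(** For [q != 0] this is the chain rule applied to [dual_volume_derive]; for
    [q = 0] the dual volume is [ball_volume R n] and the formula is
    [ln_dual_volume0_derive]. *)
Theorem ln_dual_volume_derive q :
  is_derive (0 : R) (1 : R)
    (fun t => ln (normalized_dual_volume q (wulff_shape Omega (h t))))
    ((dual_volume q (wulff_shape Omega h0))^-1 *
      dual_curvature_integral q (wulff_shape Omega h0) Omega f).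
Proof.
have [->|q0] := eqVneq q 0.
  rewrite dual_volume0; apply/is_derive0P; rewrite K00.
  exact: ln_dual_volume0_derive.
have w0 : 0 < ball_volume R n := (lebesgue_rV_ball R n_gt0).1.
have V0 := dual_volume_gt0 q.
have dV : is_derive (0 : R) (1 : R)
    (fun t => dual_volume q (wulff_shape Omega (h t)))
    (q * dual_curvature_integral q (wulff_shape Omega h0) Omega f).
  by apply/is_derive0P; rewrite K00; exact: dual_volume_derive.
have -> : (fun t => ln (normalized_dual_volume q (wulff_shape Omega (h t)))) =
    (fun t => q^-1 *
       ln ((ball_volume R n)^-1 * dual_volume q (wulff_shape Omega (h t)))).
  by apply/funext => t; exact: ln_normalized_dual_volume.
have wi : 0 < (ball_volume R n)^-1 by rewrite invr_gt0.
have V00 : 0 < dual_volume q (wulff_shape Omega (h 0)) by rewrite K00.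
have := is_derive_scaled_ln q^-1 wi V00 dV.
by rewrite K00 mulrA mulKf// mulrC.
Qed.

End variational_formula.

Theorem theorem4p5 (R : realType) (n : nat) (Omega : set 'rV[R]_n)
    (h0 f : 'rV[R]_n -> R) (h : R -> 'rV[R]_n -> R) :
  (0 < n)%N ->
  Omega `<=` sphere ->
  closed Omega ->
  (forall u, sphere u -> ~ (Omega `<=` closed_hemisphere u)) ->
  {within Omega, continuous h0} ->
  (forall v, Omega v -> 0 < h0 v) ->
  {within Omega, continuous f} ->
  log_family Omega h0 f h ->
  [/\ forall q : R, q != 0 ->
        (dual_volume q (wulff_shape Omega (h t)) -
           dual_volume q (wulff_shape Omega h0)) / t @[t --> 0^'] -->
        q * dual_curvature_integral q (wulff_shape Omega h0) Omega f,
      (ln (normalized_dual_volume 0 (wulff_shape Omega (h t))) -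
         ln (normalized_dual_volume 0 (wulff_shape Omega h0))) / t
        @[t --> 0^'] -->
      (ball_volume R n)^-1 *
        dual_curvature_integral 0 (wulff_shape Omega h0) Omega f &
      forall q : R,
        is_derive (0 : R) (1 : R)
          (fun t => ln (normalized_dual_volume q (wulff_shape Omega (h t))))
          ((dual_volume q (wulff_shape Omega h0))^-1 *
             dual_curvature_integral q (wulff_shape Omega h0) Omega f)].
Proof.
move=> n_gt0 sOmega clOmega hemi ch0 h0_gt0 cf [delta [err [delta0 h00 Hh Ho]]].
have cOmega : compact Omega.
  exact: subclosed_compact clOmega (@compact_sphere R n) sOmega.
have Omega0 : Omega !=set0.
  apply/set0P/negP => /eqP O0.
  have Se : sphere (delta_mx ord0 (Ordinal n_gt0) : 'rV[R]_n).
    by rewrite /sphere/= /enorm dot_delta mxE !eqxx sqrtr1.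
  by apply: (hemi _ Se); rewrite O0.
have o_small : forall e : R, 0 < e -> \forall t \near (0 : R)^',
    forall v, Omega v -> `|err t v / t| <= e.
  move=> e e0.
  have N : nbhs ((fun=> 0) : {uniform` Omega -> R})
      [set k : {uniform` Omega -> R} | forall v, Omega v -> `|k v| <= e].
    apply/uniform_nbhs; exists [set xy | ball xy.1 e xy.2]; split.
      exact: (entourage_ball _ (PosNum e0)).
    move=> k /= kP v Ov; have := kP v Ov.
    by rewrite /ball/= sub0r normrN => /ltW.
  exact: (Ho _ N).
have ch t : `|t| < delta -> {within Omega, continuous (h t)} by case/Hh.
have h_gt0 t v : `|t| < delta -> Omega v -> 0 < h t v.
  by case/Hh => _ _ H /H[].
have ln_h t v : `|t| < delta -> Omega v ->
    ln (h t v) = ln (h0 v) + (t * f v + err t v).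
  by case/Hh => _ _ H /H[_ ->]; rewrite addrA.
split.
- move=> q _.
  exact: (dual_volume_derive n_gt0 Omega0 cOmega sOmega hemi ch0 h0_gt0 cf
    delta0 h00 ch h_gt0 ln_h o_small).
- exact: (ln_dual_volume0_derive n_gt0 Omega0 cOmega sOmega hemi ch0 h0_gt0 cf
    delta0 h00 ch h_gt0 ln_h o_small).
- move=> q.
  exact: (ln_dual_volume_derive n_gt0 Omega0 cOmega sOmega hemi ch0 h0_gt0 cf
    delta0 h00 ch h_gt0 ln_h o_small).
Qed.
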